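(* Let $(R,\mathfrak{m})$ be a 3-dimensional regular local ring with $\mathfrak{m}=(x,y,z)R$, and let $S=\bigcup_{n\ge 0}R_n$ be the directed union of the sequence of local monoidal transforms $\{R_n\}$ of $R$ described in the context. Then $S$ is a GCD domain.
   Context: Put $R_0=R$. For every $n\ge 0$ define inductively: - $R_{2n}$ is a regular local ring with maximal ideal $\left(x,\frac{y}{x^nz^n},z\right)R_{2n}$, and $R_{2n+1}=R_{2n}\left[\frac{y}{x^{n+1}z^n}\right]$ localized at the maximal ideal generated by $x,\frac{y}{x^{n+1}z^n},z$; that is, $R_{2n+1}$ is the local monoidal transform of $R_{2n}$ obtained by blowing up the prime ideal $\left(x,\frac{y}{x^nz^n}\right)R_{2n}$ and dividing by $x$. - $R_{2n+2}=R_{2n+1}\left[\frac{y}{x^{n+1}z^{n+1}}\right]$ localized at the maximal ideal generated by $x,\frac{y}{x^{n+1}z^{n+1}},z$; that is, $R_{2n+2}$ is the local monoidal transform of $R_{2n+1}$ obtained by blowing up the prime ideal $\left(\frac{y}{x^{n+1}z^n},z\right)R_{2n+1}$ and dividing by $z$. A GCD domain is a domain $D$ such that $aD\cap bD$ is principal for all $a,b\in D$. *)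

(* Defs.v *)
From HB Require Import structures.
From mathcomp Require Import all_boot all_order all_algebra.
From mathcomp Require Import all_classical.
Set Implicit Arguments.
Unset Strict Implicit.
Unset Printing Implicit Defensive.
Import GRing.Theory.
Local Open Scope classical_set_scope.
Local Open Scope ring_scope.

Notation "x %:F" := (@FracField.tofrac _ x) : ring_scope.

(* The ideal sA of the subring A generated by the finite sequence s. *)
Definition ideal_gen (T : comNzRingType) (A : set T) (s : seq T) : set T :=
  [set u | exists2 c : 'I_(size s) -> T,
      forall i, A (c i) & u = \sum_(i < size s) c i * s`_i].

(* [idealr_closed] includes properness (1 is excluded), so the unit ideal, which
   is generated by 1, is not quantified over here. *)
Definition noetherian_ring (R : comNzRingType) : Prop :=
  forall I : set R, idealr_closed [in I] -> exists s : seq R, I = ideal_gen setT s.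

Definition maximal_ideal (R : comNzRingType) (M : set R) : Prop :=
  idealr_closed [in M] /\
  forall I : set R, idealr_closed [in I] -> M `<=` I -> I = M.

Definition local_ring (R : comNzRingType) (m : set R) : Prop :=
  maximal_ideal m /\ forall M : set R, maximal_ideal M -> M = m.

Definition prime_ideal (R : comNzRingType) (P : set R) : Prop :=
  idealr_closed [in P] /\ prime_idealr_closed [in P].

Definition prime_chain (R : comNzRingType) (d : nat) (P : 'I_d.+1 -> set R) : Prop :=
  (forall i, prime_ideal (P i)) /\ forall i j : 'I_d.+1, (i < j)%N -> P i `<` P j.

Definition has_krull_dim (R : comNzRingType) (d : nat) : Prop :=
  (exists P : 'I_d.+1 -> set R, prime_chain P) /\
  forall (e : nat) (P : 'I_e.+1 -> set R), prime_chain P -> (e <= d)%N.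

Definition regular_local_ring (R : comNzRingType) (m : set R) (d : nat) : Prop :=
  [/\ noetherian_ring R, local_ring m, has_krull_dim R d
    & exists s : d.-tuple R, m = ideal_gen setT s].

(* A[t], inside the field K. *)
Definition adjoin (K : fieldType) (A : set K) (t : K) : set K :=
  [set p.[t] | p in [set p : {poly K} | forall i, A p`_i]].

Definition localization (K : fieldType) (A P : set K) : set K :=
  [set a / s | a in A & s in A `\` P].

(* A[t] localized at its ideal (x, t, z). *)
Definition local_adjoin (K : fieldType) (A : set K) (x t z : K) : set K :=
  localization (adjoin A t) (ideal_gen (adjoin A t) [:: x; t; z]).

Section MonoidalSequence.
Variables (K : fieldType) (R0 : set K) (x y z : K).

(* The two kinds of steps alternate, and the element adjoined to the n-th ring is
   y / (x^(k+1) z^k) for n = 2k and y / (x^(k+1) z^(k+1)) for n = 2k+1. *)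
Fixpoint monoidal_seq (n : nat) : set K :=
  if n is n'.+1 then
    local_adjoin (monoidal_seq n') x (y / (x ^+ n'./2.+1 * z ^+ uphalf n')) z
  else R0.

Lemma monoidal_seq_odd n : monoidal_seq n.*2.+1 =
  local_adjoin (monoidal_seq n.*2) x (y / (x ^+ n.+1 * z ^+ n)) z.
Proof. by rewrite /= doubleK uphalf_double. Qed.

Lemma monoidal_seq_even n : monoidal_seq n.*2.+2 =
  local_adjoin (monoidal_seq n.*2.+1) x (y / (x ^+ n.+1 * z ^+ n.+1)) z.
Proof. by rewrite /= uphalf_double doubleK. Qed.

End MonoidalSequence.

(* A subring D of a field, as a GCD domain. *)
Definition gcd_domain (K : fieldType) (D : set K) : Prop :=
  subring_closed [in D] /\
  forall a b, D a -> D b ->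
    exists2 c, D c &
      [set a * d | d in D] `&` [set b * d | d in D] = [set c * d | d in D].

(* Main.v *)
(* Krull's principal ideal theorem, applied to a chain of four primes of [R],
   shows that [(y)], [(x, y)] and [(z, y)] are prime. Put [q = xz] and let [A] be
   the localization of [R] at the elements congruent to a power of [q] modulo
   [y]. The union of the sequence is the pullback ring [S = R + yA], so that
   [S/yA = R/(y)] and [A = S[1/q]].
   [A] is a GCD domain, although factoriality of [R] is not used: [y] is a prime
   of [A] in its Jacobson radical and [A/yA = (R/(y))[1/q]] is a principal ideal
   domain, so by Nakayama every ideal of [A] on which [y] can be cancelled is
   principal.
   Every nonzero element of [A] is [y^k x^i z^j a] with [a] in [S] divisible
   neither by [x] nor by [z], where [i] and [j] may be negative. Since [yA] is
   contained in [S], divisibility in [S] is divisibility of the [a]'s in [A]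
   together with the order on the exponents that compares [k] first and then
   [(i, j)] componentwise; both are lattice orders. *)
Require Import Defs.
From mathcomp Require Import all_boot all_order all_algebra.
From mathcomp Require Import all_classical.
From mathcomp Require Import ring zify.
Set Implicit Arguments.
Unset Strict Implicit.
Unset Printing Implicit Defensive.
Import Order.TTheory GRing.Theory Num.Theory.
Local Open Scope classical_set_scope.
Local Open Scope ring_scope.


(** * Ideals of Noetherian rings *)

Section Ideals.
Variable R : comNzRingType.
Implicit Types (I J P Q U : set R) (a b u v y : R).

(** The unit ideal is included, unlike in [idealr_closed], because the colon ideals and saturations
    below may be the whole ring. *)
Definition ideal I : Prop :=
  I 0 /\ forall a u v, I u -> I v -> I (a * u + v).

Definition is_prime I : Prop :=
  [/\ ideal I, ~ I 1 & forall u v, I (u * v) -> I u \/ I v].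

Lemma idealD I u v : ideal I -> I u -> I v -> I (u + v).
Proof. by move=> [_ II] Iu Iv; rewrite -[u]mul1r; apply: II. Qed.

Lemma idealM I a u : ideal I -> I u -> I (a * u).
Proof. by move=> [I0 II] Iu; rewrite -[a * u]addr0; apply: II. Qed.

Lemma idealB I u v : ideal I -> I u -> I v -> I (u - v).
Proof.
by move=> [_ II] Iu Iv; have := II (-1) _ _ Iv Iu; rewrite mulN1r addrC.
Qed.

Lemma idealDl I u v : ideal I -> I u -> I (u + v) -> I v.
Proof. by move=> II Iu /idealB-/(_ _ II Iu); rewrite addrC addKr. Qed.

Lemma ideal1 I a : ideal I -> I 1 -> I a.
Proof. by move=> II /(idealM a II); rewrite mulr1. Qed.

Lemma prime_exp P a n : is_prime P -> P (a ^+ n) -> P a.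
Proof.
case=> _ P1 PM; elim: n => [/P1 //|n IHn].
by rewrite exprS => /PM[].
Qed.

Definition extend I y : set R := [set u | exists2 i, I i & exists b, u = i + b * y].

(** Adding one generator at a time through [extend] makes induction on generators direct, in
    contrast with the indexed sums of [ideal_gen]. *)
Fixpoint span (s : seq R) : set R :=
  if s is a :: s' then extend (span s') a else [set 0].

Lemma ideal_extend I y : ideal I -> ideal (extend I y).
Proof.
move=> II; split; first by exists 0; [exact: II.1|exists 0; ring].
move=> a _ _ [i Ii [b ->]] [j Ij [c ->]].
by exists (a * i + j); [exact: II.2|exists (a * b + c); ring].
Qed.

Lemma ideal_span s : ideal (span s).
Proof.
elim: s => [|a s IHs]; last exact: ideal_extend.
by split=> //= a _ _ -> ->; ring.
Qed.

Lemma sub_extend I y : I `<=` extend I y.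
Proof. by move=> i Ii; exists i => //; exists 0; ring. Qed.

Lemma mem_extend I y : ideal I -> extend I y y.
Proof. by move=> II; exists 0; [exact: II.1|exists 1; ring]. Qed.

Lemma extend_sub I J y : ideal J -> I `<=` J -> J y -> extend I y `<=` J.
Proof.
by move=> IJ sIJ Jy _ [i Ii [b ->]]; apply: idealD => //; [exact: sIJ|exact: idealM].
Qed.

Lemma span_sub s I : ideal I -> (forall a, a \in s -> I a) -> span s `<=` I.
Proof.
move=> II; elim: s => [_ _ ->|a s IHs Is]; first exact: II.1.
apply: extend_sub => //; last by apply: Is; rewrite mem_head.
by apply: IHs => b sb; apply: Is; rewrite inE sb orbT.
Qed.

Lemma span1_sub I a : ideal I -> I a -> span [:: a] `<=` I.
Proof. by move=> II Ia; apply: span_sub => // b; rewrite inE => /eqP ->. Qed.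

Lemma mem_span s a : a \in s -> span s a.
Proof.
elim: s => // b s IHs; rewrite inE => /orP[/eqP ->|/IHs].
  exact: mem_extend (ideal_span s).
exact: sub_extend.
Qed.

Lemma ideal_gen_span s : ideal_gen setT s = span s.
Proof.
apply/seteqP; split=> [_ [c _ ->]|].
  elim/big_ind: _ => [||i _]; first exact: (ideal_span s).1.
    by move=> u v; apply: idealD (ideal_span s).
  by apply: idealM (ideal_span s) _; apply: mem_span; rewrite mem_nth.
elim: s => [_ ->|a s IHs _ [i /IHs[c _ ->] [b ->]]].
  by exists (fun=> 0); rewrite ?big_ord0.
exists (fun k => oapp c b (unlift ord0 k)) => //.
rewrite big_ord_recl unlift_none /= addrC; congr (_ + _).
by apply: eq_bigr => k _; rewrite liftK.
Qed.

Lemma ideal_in I : idealr_closed [in I] <-> ideal I /\ ~ I 1.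
Proof.
split=> [[I0 I1 II]|[[I0 II] I1]].
  split; last by move=> ?; move/negP: I1; apply; rewrite inE.
  split=> [|a u v Iu Iv]; first by move: I0; rewrite inE.
  by have /(_ a u v) := II; rewrite !inE; apply.
split; [by rewrite inE|by apply/negP; rewrite inE|].
by move=> a u v; rewrite !inE => Iu Iv; apply: II.
Qed.

Lemma prime_in P : prime_ideal P <-> is_prime P.
Proof.
split=> [[/ideal_in[IP P1] PM]|[IP P1 PM]].
  split=> // u v Puv; have := PM u v; rewrite !inE => /(_ Puv) /orP[].
    by rewrite inE; left.
  by rewrite inE; right.
split; first exact/ideal_in.
by move=> u v; rewrite inE => /PM[]; rewrite -inE => ->; rewrite ?orbT.
Qed.

(** * Maximal members, Nakayama's lemma and the principal ideal theorem *)

Section Noetherian.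
Hypothesis noethR : noetherian_ring R.

Lemma noetherian_span I : ideal I -> exists s, I = span s.
Proof.
move=> II; have [I1|I1] := pselect (I 1).
  exists [:: 1]; apply/seteqP; split=> [a _|a _]; last exact: ideal1.
  by exists 0 => //; exists a; ring.
have [|s ->] := noethR (I := I); first exact/ideal_in.
by exists s; rewrite ideal_gen_span.
Qed.

(** Without a maximal member, a choice of strictly larger members yields an ascending chain. Its
    union is finitely generated, and the generators already lie in one term. *)
Lemma noetherian_max (C : set (set R)) (I0 : set R) :
  (forall I, C I -> ideal I) -> C I0 ->
  exists2 I, C I & forall J, C J -> I `<=` J -> J `<=` I.
Proof.
move=> Cid C0; apply: contrapT => nomax.
have /choice[f fP] (I : set R) :
    exists J, C I -> [/\ C J, I `<=` J & ~ J `<=` I].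
  have [CI|nCI] := pselect (C I); last by exists I => /nCI.
  apply: contrapT => noJ; apply: nomax; exists I => // J CJ sIJ.
  by apply: contrapT => nJI; apply: noJ; exists J.
pose F n := iter n f I0.
have CF n : C (F n) by elim: n => // n /fP[].
have monoF p n : (p <= n)%N -> F p `<=` F n.
  elim: n => [|n IHn]; first by rewrite leqn0 => /eqP ->.
  rewrite leq_eqVlt => /predU1P[-> //|]; rewrite ltnS => /IHn s a /s.
  by have [_ + _] := fP _ (CF n); apply.
have IU : ideal (\bigcup_n F n).
  split; first by exists 0%N => //; exact: (Cid _ (CF 0%N)).1.
  move=> a u v [i _ Fu] [j _ Fv]; exists (maxn i j) => //.
  apply: (Cid _ (CF _)).2; first exact: monoF (leq_maxl _ _) _ Fu.
  exact: monoF (leq_maxr _ _) _ Fv.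
have [s Us] := noetherian_span IU.
have [n sn] : exists n, forall a, a \in s -> F n a.
  have : forall a, a \in s -> (\bigcup_n F n) a by rewrite Us => a /mem_span.
  elim: s {Us} => [|b s IHs] sF; first by exists 0%N.
  have [|n Fn] := IHs; first by move=> a sa; apply: sF; rewrite inE sa orbT.
  have [p _ Fp] := sF b (mem_head b s).
  exists (maxn n p) => a; rewrite inE => /predU1P[->|/Fn].
    exact: monoF (leq_maxr _ _) _ Fp.
  exact: monoF (leq_maxl _ _) _.
have [_ _] := fP _ (CF n); apply => a Fa.
apply: (span_sub (Cid _ (CF n)) sn); rewrite -Us.
by exists n.+1.
Qed.

Lemma noetherian_ind (T : set R -> Prop) :
  (forall I, ideal I ->
     (forall J, ideal J -> I `<=` J -> ~ J `<=` I -> T J) -> T I) ->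
  forall I, ideal I -> T I.
Proof.
move=> step I II; apply: contrapT => nTI.
have [||J [IJ nTJ] Jmax] := @noetherian_max [set J | ideal J /\ ~ T J] I.
- by move=> J [].
- by [].
apply: nTJ; apply: step => // J' IJ' sJJ' nJ'J.
by apply: contrapT => nTJ'; apply: nJ'J; apply: Jmax.
Qed.

(* [U] is a multiplicative set, so this is Nakayama's lemma in [U^-1 R], with the
   denominators cleared. *)
Lemma nakayama U I J y :
  U 1 -> (forall u v, U u -> U v -> U (u * v)) -> ideal I -> ideal J ->
  (forall j, J j -> exists u k, [/\ U u, J k & I (u * j - y * k)]) ->
  exists u e, U u /\ forall j, J j -> I ((u + y * e) * j).
Proof.
move=> U1 UM II IJ hyp.
(* The multipliers [u + y e] are closed under products, so induction on the generators of [J] can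
   collect one factor per generator. *)
pose V : set R := [set v | exists2 u, U u & exists e, v = u + y * e].
have V1 : V 1 by exists 1 => //; exists 0; ring.
have VM u v : V u -> V v -> V (u * v).
  move=> [u' Uu [e ->]] [v' Uv [e' ->]]; exists (u' * v'); first exact: UM.
  by exists (u' * e' + e * v' + y * e * e'); ring.
suff [v [u Uu [e ->]] vP] : exists2 v, V v & forall j, J j -> I (v * j).
  by exists u, e.
have [s Js] := noetherian_span IJ.
have {hyp} : forall a, a \in s ->
    exists v k, [/\ V v, span s k & I (v * a - y * k)].
  rewrite -Js => a sa; have [|u [k [Uu Jk Ik]]] := hyp a.
    by rewrite Js; apply: mem_span.
  by exists u, k; split=> //; exists u => //; exists 0; ring.
suff H v : ideal [set j | I (v * j)].
  rewrite Js => {Js IJ J}; elim: s => [_|a s IHs hyp].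
    by exists 1 => // _ ->; rewrite mulr0; exact: II.1.
  have [u [_ [Vu [k sk [b ->]] Iu]]] := hyp a (mem_head _ _).
  (* The relation for [a] becomes [v a = y k] modulo [I], with [k] in the span of the other
     generators. Multiplying their relations by [v] eliminates [a] from them. *)
  pose v := u - y * b.
  have Vv : V v.
    case: Vu => u' Uu [e ue]; exists u' => //; exists (e - b).
    by rewrite /v ue; ring.
  have Iv : I (v * a - y * k).
    by rewrite (_ : _ - _ = u * a - y * (k + b * a)) // /v; ring.
  have [|v' Vv' v'P] := IHs.
    move=> c sc; have [|u' [_ [Vu' [k' sk' [b' ->]] Iu']]] := hyp c.
      by rewrite inE sc orbT.
    exists (v * u'), (b' * (y * k) + v * k'); split; first exact: VM.
      apply: idealD (ideal_span s) _ _; rewrite ?mulrA; first exact: idealM (ideal_span s) _.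
      exact: idealM (ideal_span s) _.
    rewrite (_ : _ - _ = v * (u' * c - y * (k' + b' * a)) + y * b' * (v * a - y * k)).
      by apply: idealD => //; apply: idealM.
    by ring.
  exists (v * v'); first exact: VM.
  apply: (extend_sub (H _)) => [j sj /=|/=].
    by rewrite -mulrA; apply: idealM => //; apply: v'P.
  rewrite (_ : _ * a = v' * (v * a - y * k) + y * (v' * k)); last by ring.
  by apply: idealD => //; apply: idealM => //; apply: v'P.
split=> [/=|a b c /= Ib Ic]; first by rewrite mulr0; exact: II.1.
by rewrite (_ : _ * _ = a * (v * b) + v * c); [apply: II.2|ring].
Qed.

(* The localization at [P] of the quotient by [I] is Artinian when [P] is the
   only is_prime between [I] and [P]; the ideals of the localization are encoded as
   the ideals that are saturated with respect to the complement of [P]. *)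
Lemma minimal_prime_dcc P I : is_prime P -> ideal I ->
  (forall Q, is_prime Q -> I `<=` Q -> Q `<=` P -> P `<=` Q) ->
  forall J : nat -> set R, (forall n, ideal (J n)) ->
  (forall n, J n.+1 `<=` J n) -> (forall n, I `<=` J n) ->
  (forall n s r, ~ P s -> J n (s * r) -> J n r) ->
  exists N, forall n, (N <= n)%N -> J N `<=` J n.
Proof.
move=> primeP; move: I.
have [IP P1 PM] := primeP.
apply: noetherian_ind => I II IHI minP J IJ decJ sIJ satJ.
have anti p n : (p <= n)%N -> J n `<=` J p.
  elim: n => [|n IHn]; first by rewrite leqn0 => /eqP ->.
  by rewrite leq_eqVlt => /predU1P[-> //|]; rewrite ltnS => /IHn s a /decJ/s.
have full n s : ~ P s -> J n s -> forall r, J n r.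
  move=> nPs Js r; apply: (satJ n s) => //.
  by rewrite mulrC; apply: idealM.
have [I1|I1] := pselect (I 1).
  by exists 0%N => n _ r _; apply: (full _ 1) => //; apply: sIJ.
(* A prime [I] inside [P] equals [P] by minimality; otherwise [I] meets the complement of [P].
   Either way every [J n] contains [P], so it is [P] or the whole ring. *)
have [primeI|nprimeI] := pselect (is_prime I).
  have sPJ n : P `<=` J n.
    have [sIP|nsIP] := pselect (I `<=` P).
      by move=> a /(minP I primeI) Ia; apply: sIJ; apply: Ia.
    have [s Is nPs] : exists2 s, I s & ~ P s.
      apply: contrapT => no; apply: nsIP => a Ia.
      by apply: contrapT => nPa; apply: no; exists a.
    by move=> a _; apply: (full n s) => //; apply: sIJ.
  have [allJ|] := pselect (forall n, J n 1).
    by exists 0%N => n _ r _; apply: ideal1.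
  move=> /existsNP[N JN1]; exists N => n leNn a Ja; apply: sPJ.
  by apply: contrapT => nPa; apply: JN1; apply: (full N a).
have [a [b [Iab nIa nIb]]] : exists a b, [/\ I (a * b), ~ I a & ~ I b].
  apply: contrapT => no; apply: nprimeI; split=> // u v Iuv.
  apply: contrapT => /not_orP[nIu nIv]; apply: no; by exists u, v.
(* The chain is controlled by its saturated sums with [a] and its colon ideals by [a]. Induction
   applies to them over [I + (a)] and [(I : a)], which are strictly larger than [I]: the second
   contains [b]. *)
pose K n := [set r | exists2 s, ~ P s & extend (J n) a (s * r)].
pose L n := [set r | J n (r * a)].
have [||||||||N1 KP] := IHI (extend I a) _ _ _ _ K.
- exact: ideal_extend.
- exact: sub_extend.
- by move=> /(_ a (mem_extend a II)).
- move=> Q primeQ sQ; apply: minP => // r Ir; apply: sQ; exact: sub_extend.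
- move=> n; split; first by exists 1; rewrite // mulr0; exact: (ideal_extend a (IJ n)).1.
  move=> c u v [s Ps Ks] [t Pt Kt]; exists (s * t); first by move=> /PM[].
  rewrite (_ : _ * _ = (t * c) * (s * u) + s * (t * v)); last by ring.
  by have IE := ideal_extend a (IJ n); apply: IE.2 => //; apply: idealM.
- move=> n r [s Ps Ks]; exists s => //; move: Ks.
  apply: extend_sub; first exact: ideal_extend (IJ n).
    by move=> u /decJ; apply: sub_extend.
  exact: mem_extend (IJ n).
- move=> n r Ir; exists 1 => //; rewrite mul1r.
  move: Ir; apply: extend_sub; first exact: ideal_extend (IJ n).
    by move=> u /(sIJ n); apply: sub_extend.
  exact: mem_extend (IJ n).
- by move=> n s r Ps [t Pt Kt]; exists (t * s); [move=> /PM[]|rewrite -mulrA].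
have IL n : ideal (L n).
  split=> [|c u v Lu Lv]; rewrite /L /=; first by rewrite mul0r; exact: (IJ n).1.
  by rewrite mulrDl -mulrA; apply: (IJ n).2.
have [||||||||N2 LP] := IHI [set r | I (r * a)] _ _ _ _ L.
- split=> [|c u v Lu Lv] /=; first by rewrite mul0r; exact: II.1.
  by rewrite mulrDl -mulrA; apply: II.2.
- by move=> r Ir /=; rewrite mulrC; apply: idealM.
- by move=> /(_ b) /=; rewrite mulrC => /(_ Iab).
- move=> Q primeQ sQ; apply: minP => // r Ir; apply: sQ => /=.
  by rewrite mulrC; apply: idealM.
- exact: IL.
- by move=> n r; apply: decJ.
- by move=> n r; apply: sIJ.
- by move=> n s r Ps; rewrite /L /= -mulrA; apply: satJ.
exists (maxn N1 N2) => n; rewrite geq_max => /andP[le1 le2] r Jr.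
(* Stability of [K] gives [s r = j + c a] with [j] in [J n]. Then [c] lies in the stable colon
   ideal, so [c a] is in [J n], and so is [r] by saturation. *)
have [|s Ps] := KP n le1 r.
  by exists 1 => //; rewrite mul1r; apply: sub_extend; apply: anti Jr; exact: leq_maxl.
case=> j Jj [c sr]; apply: (satJ _ s) => //; rewrite sr.
apply: idealD => //; apply: (LP n le2).
rewrite /L /= (_ : c * a = s * r - j); last by rewrite sr; ring.
apply: idealB => //; last exact: anti le2 _ Jj.
by apply: idealM => //; apply: anti Jr; exact: leq_maxr.
Qed.

(* Krull's principal ideal theorem, in the form used to push an element down a
   chain of primes. *)
Lemma prime_chain_through P0 P1 P2 y :
  is_prime P0 -> is_prime P1 -> is_prime P2 -> P0 `<` P1 -> P1 `<` P2 -> P2 y ->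
  exists Q, [/\ is_prime Q, P0 `<` Q, Q `<` P2 & Q y].
Proof.
move=> p0 p1 p2 s01 s12 P2y.
have [P0y|P0y] := pselect (P0 y); first by exists P1; split=> //; apply: s01.1.
apply: contrapT => noQ.
have [[[I0 _ P0M] [I1 _ P1M]] [I2 P21 P2M]] := (p0, p1, p2).
(* If no intermediate prime contains [y], then [P2] is minimal over [P0 + (y)], so the descending
   chain condition is available. *)
have min2 Q : is_prime Q -> extend P0 y `<=` Q -> Q `<=` P2 -> P2 `<=` Q.
  move=> primeQ sQ sQ2; apply: contrapT => ns; apply: noQ; exists Q.
  have Qy : Q y by apply: sQ; apply: mem_extend.
  split=> //; split=> // [a P0a|sQ0]; first by apply: sQ; apply: sub_extend.
  exact/P0y/sQ0.
have P1y : ~ P1 y.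
  move=> P1y; apply: s12.2; apply: min2 => //; last exact: s12.1.
  by apply: extend_sub => //; apply: s01.1.
have [a P1a P0a] : exists2 a, P1 a & ~ P0 a.
  by apply: contrapT => no; apply: s01.2 => a P1a; apply: contrapT => ?; apply: no; exists a.
(* Contraction to [R] of the ideal generated by [P0] and [a ^+ n] in the localization at [P1]: the
   analogue of a symbolic power. *)
pose J n := [set r | exists2 s, ~ P1 s & extend P0 (a ^+ n) (s * r)].
have IJ n : ideal (J n).
  have IE := ideal_extend (a ^+ n) I0.
  split; first by exists 1; [case: p1|rewrite mulr0; exact: IE.1].
  move=> c u v [s Ps Ks] [t Pt Kt]; exists (s * t); first by move=> /P1M[].
  rewrite (_ : _ * _ = (t * c) * (s * u) + s * (t * v)); last by ring.
  by apply: IE.2 => //; apply: idealM.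
have decJ n : J n.+1 `<=` J n.
  move=> r [s Ps Ks]; exists s => //; move: Ks.
  apply: extend_sub; first exact: ideal_extend.
    exact: sub_extend.
  by rewrite exprS; apply: idealM (ideal_extend _ I0) _; apply: mem_extend.
have satJ n s r : ~ P1 s -> J n (s * r) -> J n r.
  by move=> Ps [t Pt Kt]; exists (t * s); [move=> /P1M[]|rewrite -mulrA].
pose K n := [set r | exists2 s, ~ P2 s & extend (J n) y (s * r)].
have [||||N KP] := minimal_prime_dcc p2 (ideal_extend y I0) min2 (J := K).
- move=> n; have IE := ideal_extend y (IJ n).
  split; first by exists 1; rewrite // mulr0; exact: IE.1.
  move=> c u v [s Ps Ks] [t Pt Kt]; exists (s * t); first by move=> /P2M[].
  rewrite (_ : _ * _ = (t * c) * (s * u) + s * (t * v)); last by ring.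
  by apply: IE.2 => //; apply: idealM.
- move=> n r [s Ps Ks]; exists s => //; move: Ks.
  apply: extend_sub; first exact: ideal_extend (IJ n).
    by move=> u /decJ; apply: sub_extend.
  exact: mem_extend (IJ n).
- move=> n r Ir; exists 1 => //; rewrite mul1r; move: Ir.
  apply: extend_sub; first exact: ideal_extend (IJ n).
    move=> u P0u; apply: sub_extend; exists 1; first by case: p1.
    by rewrite mul1r; apply: sub_extend.
  exact: mem_extend (IJ n).
- by move=> n s r Ps [t Pt Kt]; exists (t * s); [move=> /P2M[]|rewrite -mulrA].
(* Stability gives [s r = j + c y] with [j] in [J N.+1]. As [y] is outside [P1] it cancels, so [c]
   is in [J N], and Nakayama carries [J N] into [J N.+1] up to a multiplier. *)
have [|||||u [e [P2u uP]]] := @nakayama [set s | ~ P2 s] (J N.+1) (J N) y.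
- exact: P21.
- by move=> u v P2u P2v /P2M[].
- exact: IJ.
- exact: IJ.
- move=> r Jr; have [|s P2s [j Jj [c sr]]] := KP N.+1 (leqnSn N) r.
    by exists 1 => //; rewrite mul1r; apply: sub_extend.
  exists s, c; split=> //; last by rewrite sr [y * c]mulrC addrK.
  apply: (satJ _ y) => //; rewrite (_ : y * c = s * r - j); last by rewrite sr; ring.
  by apply: idealB => //; [exact: idealM|exact: decJ].
have JaN : J N (a ^+ N).
  by exists 1; [case: p1|rewrite mul1r; apply: mem_extend].
have [s P1s [i P0i [c eqi]]] : J N.+1 (a ^+ N).
  apply: (satJ N.+1 (u + y * e)); last exact: uP JaN.
  move=> /s12.1 P2u'; apply: P2u; apply: (idealDl I2 (u := y * e)).
    by rewrite mulrC; apply: idealM.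
  by rewrite addrC.
(* Cancelling [a ^+ N] modulo [P0] puts [s - c a], hence [s], in [P1], against the choice of [s]. *)
have : P0 (a ^+ N * (s - c * a)).
  by rewrite (_ : _ * _ = i) // mulrBr [_ * s]mulrC eqi exprS; ring.
move=> /P0M[/(prime_exp p0)//|/s01.1 P1sc]; apply: P1s.
rewrite -[s](subrK (c * a)); apply: idealD => //; exact: idealM.
Qed.

End Noetherian.
End Ideals.

(** * Regular local rings of dimension 3 *)

Section LocalRings.
Variables (R : comNzRingType) (m : set R).
Hypotheses (noethR : noetherian_ring R) (locR : local_ring m).
Implicit Types (I J P : set R) (a b x y z : R).

(** A nonunit [a] lies in an ideal maximal among the proper ones containing it, and locality
    identifies that ideal with [m]. *)
Lemma local_unit a : ~ m a -> exists b, b * a = 1.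
Proof.
move=> nma; apply: contrapT => nua.
have Ia : span [:: a] a by apply: mem_span; rewrite mem_head.
have [||M [IM M1 Ma] maxM] := @noetherian_max _ noethR
    [set I | [/\ ideal I, ~ I 1 & I a]] (span [:: a]).
- by move=> I [].
- split=> //; first exact: ideal_span.
  by case=> i -> [b]; rewrite add0r => eqb; apply: nua; exists b.
case: locR => _ /(_ M) eqM; apply: nma; rewrite -eqM //; split.
  exact/ideal_in.
move=> I /ideal_in[II I1] sMI; apply/seteqP; split=> //.
by apply: maxM => //; split=> //; apply: sMI.
Qed.

Lemma local_prime : is_prime m.
Proof.
case: locR => -[/ideal_in[Im m1] _] _; split=> // u v muv.
apply: contrapT => /not_orP[/local_unit[u' uu] /local_unit[v' vv]].
by apply: m1; rewrite -[1]mulr1 -{1}uu -vv mulrACA; apply: idealM.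
Qed.

Lemma sub_local I : ideal I -> ~ I 1 -> I `<=` m.
Proof.
move=> II I1 a Ia; apply: contrapT => /local_unit[b ab].
by apply: I1; rewrite -ab; apply: idealM.
Qed.

(** With [U] reduced to [1], the multiplier given by [nakayama] is [1 + y e], a unit because [y] is
    in [m]. *)
Lemma nakayama_local I J y : ideal I -> ideal J -> m y ->
  (forall j, J j -> exists2 k, J k & I (j - y * k)) -> J `<=` I.
Proof.
move=> II IJ my hyp; have [Im m1 _] := local_prime.
have [|||||_ [e [-> eP]] j Jj] := @nakayama _ noethR [set 1] I J y => //.
- by move=> u v -> ->; rewrite mulr1.
- by move=> j /hyp[k Jk Ik]; exists 1, k; rewrite mul1r.
have [b be] : exists b, b * (1 + y * e) = 1.
  apply: local_unit => m1e; apply: m1; apply: (idealDl Im (u := y * e)).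
    by rewrite mulrC; apply: idealM.
  by rewrite addrC.
by rewrite -[j]mul1r -be -mulrA; apply: idealM => //; apply: eP.
Qed.

(** The elements lying in every [P + (x^n)] form an ideal contained in its own [x]-multiple modulo
    [P], hence in [P] by Nakayama. So only finitely many powers of [x] can be extracted from [r]. *)
Lemma prime_power_factor P x r : is_prime P -> m x -> ~ P x -> ~ P r ->
  exists n g, P (r - x ^+ n * g) /\ ~ extend P x g.
Proof.
move=> [IP P1 PM] mx nPx nPr.
pose J := [set s | forall n, exists c, P (s - x ^+ n * c)].
have nJr : ~ J r.
  apply: contra_not nPr; apply: (nakayama_local IP _ mx).
    split=> [n|a u v Ju Jv n]; first by exists 0; rewrite mulr0 subr0; exact: IP.1.
    have [[c Pc] [d Pd]] := (Ju n, Jv n); exists (a * c + d).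
    by rewrite (_ : _ - _ = a * (u - x ^+ n * c) + (v - x ^+ n * d)); [apply: IP.2|ring].
  move=> s Js; have [c Pc] := Js 1; exists c; last by rewrite -[x]expr1.
  move=> n; have [d Pd] := Js n.+1; exists d.
  have /PM[//|//] : P (x * (c - x ^+ n * d)).
  rewrite (_ : _ * _ = (s - x ^+ n.+1 * d) - (s - x ^+ 1 * c)).
    exact: idealB.
  by rewrite exprS; ring.
have exn : exists n, ~~ `[< exists c, P (r - x ^+ n * c) >].
  by apply: contrapT => no; apply: nJr => n; apply: contrapT => h;
     apply: no; exists n; apply/asboolPn.
case: (ex_minnP exn) => -[/asboolPn no _|n /asboolPn nPn minn].
  by case: no; exists r; rewrite expr0 mul1r subrr; exact: IP.1.
have [/asboolPn no|/negPn/asboolP[g Pg]] := boolP (~~ `[< exists c, P (r - x ^+ n * c) >]).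
  by have := minn n; rewrite ltnn => h; have := h (introT (asboolPn _) no).
exists n, g; split=> // -[i Pi [b gib]]; apply: nPn; exists b.
rewrite (_ : _ - _ = (r - x ^+ n * g) + x ^+ n * i).
  by apply: idealD => //; apply: idealM.
by rewrite gib exprS; ring.
Qed.

(** The chain is deformed to [P0 < Q1 < Q2 < m] with [y] in [Q1] and [x] in [Q2]. Nakayama then
    forces [Q2 = (x, y)] and [Q1 = (y)], and strictness of [P0 < Q1] gives [y <> 0]. *)
Lemma regular_primes x y z : has_krull_dim R 3 ->
  m x -> m y -> m z -> m `<=` span [:: z; x; y] ->
  [/\ y <> 0, is_prime (span [:: y]), is_prime (span [:: x; y]) & ~ span [:: x; y] z].
Proof.
move=> [[P [primeP ltP]] _] mx my mz gen.
have pm := local_prime; have [Im m1 mM] := pm.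
have [i0 i1 i2 i3] : [/\ (0 < 4)%N, (1 < 4)%N, (2 < 4)%N & (3 < 4)%N] by [].
have pP i : is_prime (P i) by apply/prime_in.
have lt01 : P (Ordinal i0) `<` P (Ordinal i1) by apply: ltP.
have lt12 : P (Ordinal i1) `<` P (Ordinal i2) by apply: ltP.
have lt2m : P (Ordinal i2) `<` m.
  have [s23 ns32] : P (Ordinal i2) `<` P (Ordinal i3) by apply: ltP.
  have s3m : P (Ordinal i3) `<=` m by apply: sub_local; case: (pP (Ordinal i3)).
  by split=> [a /s23/s3m//|sm]; apply: ns32 => a /s3m/sm.
have through := prime_chain_through noethR.
(* [y] is pushed down the chain twice, from [m] to height two and then to [Q1]; [x] is pushed once,
   from [m] to [Q2] above [Q1]. *)
have [P2 [p2 lt12' lt2m' P2y]] := through _ _ _ _ (pP _) (pP _) pm lt12 lt2m my.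
have [Q1 [q1 lt01' lt12'' Q1y]] := through _ _ _ _ (pP _) (pP _) p2 lt01 lt12' P2y.
have [Q2 [q2 lt12Q lt2Q Q2x]] := through _ _ _ _ q1 p2 pm lt12'' lt2m' mx.
have [[IQ1 _ Q1M] [IQ2 _ Q2M]] := (q1, q2).
have sxyQ : span [:: x; y] `<=` Q2.
  apply: span_sub => // a; rewrite !inE => /orP[] /eqP -> //.
  exact: lt12Q.1.
have Q2z : ~ Q2 z.
  by move=> Q2z; apply: lt2Q.2 => a /gen; apply: extend_sub.
have eqQ2 : Q2 = span [:: x; y].
  apply/seteqP; split=> //; apply: (nakayama_local (ideal_span _) _ mz) => // j Q2j.
  have [i xyi [b eqj]] : span [:: z; x; y] j by apply/gen/lt2Q.1.
  exists b; last by rewrite eqj [z * b]mulrC addrK.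
  have /Q2M[//|//] : Q2 (b * z).
  by apply: (idealDl IQ2 (sxyQ _ xyi)); rewrite -eqj.
suff eqQ1 : Q1 = span [:: y].
  rewrite -eqQ2 -eqQ1; split=> // y0; apply: lt01'.2 => a.
  rewrite eqQ1 => -[_ -> [b ->]]; rewrite y0 mulr0 addr0.
  by have [[]] := pP (Ordinal i0).
apply/seteqP; split; last exact: span1_sub.
apply: (nakayama_local (ideal_span _) _ mx) => // j Q1j.
have [i yi [b eqj]] : span [:: x; y] j by rewrite -eqQ2; apply: lt12Q.1.
exists b; last by rewrite eqj [x * b]mulrC addrK.
have nQ1x : ~ Q1 x.
  move=> Q1x; apply: lt12Q.2; rewrite eqQ2; apply: span_sub => // a.
  by rewrite !inE => /orP[] /eqP ->.
have /Q1M[//|//] : Q1 (b * x).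
by apply: (idealDl IQ1 (span1_sub IQ1 Q1y yi)); rewrite -eqj.
Qed.

(** * Principality of saturated ideals *)

Section Saturation.
Variables (x y z : R).
Hypotheses (mx : m x) (mz : m z) (gen : m `<=` span [:: z; x; y]).
Hypotheses (pxy : is_prime (span [:: x; y])) (nxyz : ~ span [:: x; y] z).

(* Modulo [(x, y)] the ring is a discrete valuation ring with uniformizer [z]. *)
Lemma saturated_principal_mod I : ideal I -> I y ->
  (forall r, I (x * r) -> I r) -> exists2 h, I h & I `<=` span [:: h; y].
Proof.
move=> II Iy satI.
(* Saturation keeps the cofactor of [x] in [I], which is the form needed for Nakayama with respect
   to [x]. *)
have down r : I r -> span [:: x; y] r -> exists2 k, I k & span [:: y] (r - x * k).
  move=> Ir [i yi [b eqr]]; exists b; last by rewrite eqr [x * b]mulrC addrK.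
  by apply: satI; apply: (idealDl II (span1_sub II Iy yi)); rewrite [x * b]mulrC -eqr.
have unitP r : I r -> ~ span [:: x; y] r -> exists n g b,
    b * g = 1 /\ span [:: x; y] (r - z ^+ n * g).
  move=> Ir nr; have [n [g [rg ng]]] := prime_power_factor pxy mz nxyz nr.
  have [|b bg] := @local_unit g; first by move/gen.
  by exists n, g, b.
have [sI|nsI] := pselect (I `<=` span [:: x; y]).
  exists y => //; apply: (nakayama_local (ideal_span _) _ mx) => // j Ij.
  have [k Ik yk] := down j Ij (sI _ Ij); exists k => //; exact: sub_extend.
(* The generator [h] is an element of [I] of least valuation modulo [(x, y)], normalized to be
   congruent to a power of [z]. *)
pose lead n := exists2 h, I h & span [:: x; y] (h - z ^+ n).
have exn : exists n, `[< lead n >].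
  apply: contrapT => no; apply: nsI => r Ir; apply: contrapT => nr.
  have [n [g [b [bg rg]]]] := unitP r Ir nr; apply: no; exists n.
  apply/asboolP; exists (b * r); first exact: idealM.
  rewrite (_ : _ - _ = b * (r - z ^+ n * g)); first exact: idealM (ideal_span _) _.
  by rewrite mulrBr mulrCA bg mulr1.
case: (ex_minnP exn) => n /asboolP[h Ih hn] minn; exists h => //.
apply: (nakayama_local (ideal_span _) _ mx) => // r Ir.
have [rxy|nr] := pselect (span [:: x; y] r).
  by have [k Ik yk] := down r Ir rxy; exists k => //; exact: sub_extend.
have [k [g [b [bg rg]]]] := unitP r Ir nr.
have lenk : (n <= k)%N.
  apply: minn; apply/asboolP; exists (b * r); first exact: idealM.
  rewrite (_ : _ - _ = b * (r - z ^+ k * g)); first exact: idealM (ideal_span _) _.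
  by rewrite mulrBr mulrCA bg mulr1.
(* Subtracting [c h] kills the image of [r] modulo [(x, y)], so the remainder is [x d] modulo [y]
   with [d] in [I]. *)
pose c := g * z ^+ (k - n).
have [||d Id yd] := down (r - c * h).
- by apply: idealB => //; apply: idealM.
- rewrite (_ : _ - _ = (r - z ^+ k * g) - c * (h - z ^+ n)).
    by apply: idealB (ideal_span _) _ _ => //; apply: idealM (ideal_span _) _.
  by rewrite /c mulrBr -[_ * z ^+ n]mulrA -exprD subnK //; ring.
exists d => //; exists (r - c * h - x * d) => //; exists c.
by ring.
Qed.

(* The ideal spanned by [J] in the localization at the [(x z)^n + y e] is
   principal. *)
Lemma saturated_principal_up_to_unit J : ideal J -> (forall r, J (y * r) -> J r) ->
  exists g n e, J g /\ forall j, J j -> exists c, ((x * z) ^+ n + y * e) * j = c * g.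
Proof.
move=> IJ satJ; pose q := x * z.
(* Contraction of the extension of [J + (y)] to [R[1/q]]; it is saturated with respect to [x]
   because [x] divides [q]. *)
pose I := [set b | exists n, extend J y (q ^+ n * b)].
have IE := ideal_extend y IJ.
have sJI j : extend J y j -> I j by exists 0%N; rewrite mul1r.
have [|||h [n [g Jg [r eqg]]] sI] := @saturated_principal_mod I.
- split; first by apply: sJI; exact: IE.1.
  move=> a u v [k Ik] [l Il]; exists (k + l)%N.
  rewrite (_ : _ * _ = (q ^+ l * a) * (q ^+ k * u) + q ^+ k * (q ^+ l * v)).
    by apply: IE.2 => //; apply: idealM.
  by rewrite exprD; ring.
- exact/sJI/mem_extend.
- move=> a [k Ik]; exists k.+1.
  rewrite (_ : _ * _ = z * (q ^+ k * (x * a))); first exact: idealM.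
  by rewrite exprS /q; ring.
have [|||||_ [e [[k _ <-] ke]]] := @nakayama _ noethR (range (fun k => q ^+ k)) (span [:: g]) J y.
- by exists 0%N.
- by move=> _ _ [k _ <-] [l _ <-]; exists (k + l)%N; rewrite ?exprD.
- exact: ideal_span.
- by [].
- move=> j Jj; have [i [_ -> [b eqi]] [a eqj]] := sI j (sJI j (sub_extend _ Jj)).
  (* The second witness is the quotient of [q ^+ n * j - a * g] by [y]. It lies in [J] because [y]
     cancels there, so [g] generates [J] modulo [y J] once [q] is inverted. *)
  exists (q ^+ n), (q ^+ n * b + a * r).
  have eqn : q ^+ n * j - y * (q ^+ n * b + a * r) = a * g.
    rewrite eqj eqi mulrDr [q ^+ n * (a * h)]mulrCA eqg; ring.
  split; [by exists n| |by rewrite eqn; exists 0 => //; exists a; rewrite add0r].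
  apply: satJ; rewrite (_ : y * _ = q ^+ n * j - a * g); last by rewrite -eqn; ring.
  by apply: idealB => //; apply: idealM.
exists g, k, e; split=> // j /ke[_ -> [c]]; rewrite add0r.
by exists c.
Qed.

End Saturation.
End LocalRings.

(** * Divisibility ordered lexicographically *)

Section LexicographicGcd.
Variables (K : fieldType) (S A : set K) (X Y Z : K).
Implicit Types a b c g s t : K.

Definition subring (D : set K) : Prop :=
  [/\ D 1, forall a b, D a -> D b -> D (a - b) & forall a b, D a -> D b -> D (a * b)].

Section Subring.
Variables (D : set K) (subD : subring D).

Lemma subringB a b : D a -> D b -> D (a - b). Proof. by case: subD => _ + _; apply. Qed.
Lemma subringM a b : D a -> D b -> D (a * b). Proof. by case: subD => _ _; apply. Qed.
Lemma subring1 : D 1. Proof. by case: subD. Qed.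
Lemma subring0 : D 0. Proof. by rewrite -(subrr 1); apply: subringB subring1 subring1. Qed.
Lemma subringN a : D a -> D (- a).
Proof. by rewrite -sub0r; apply: subringB subring0. Qed.
Lemma subringD a b : D a -> D b -> D (a + b).
Proof. by move=> Da Db; rewrite -[b]opprK; apply: subringB (subringN _). Qed.
Lemma subringX a n : D a -> D (a ^+ n).
Proof.
move=> Da; elim: n => [|n IHn]; first exact: subring1.
by rewrite exprS; apply: subringM.
Qed.

Lemma subringXz a (i : int) : D a -> D a^-1 -> D (a ^ i).
Proof. by move=> Da Dv; case: i => n; rewrite ?NegzE -?exprnN -?exprVn; apply: subringX. Qed.

End Subring.

(* Divisibility of [a] by [p] in a ring [D] is expressed as [D (a / p)]. *)
Definition prime_in_ring (D : set K) (p : K) : Prop :=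
  forall a b, D a -> D b -> D (a * b / p) -> D (a / p) \/ D (b / p).

(** Since [a s] is in [D], [p] divides the product of [a] and [p ^+ n.+1 * s]; not dividing [a], it
    divides the other factor, which removes one power of [p]. *)
Lemma cancel_prime D p a s n : subring D -> p != 0 -> D p -> prime_in_ring D p ->
  D a -> ~ D (a / p) -> D (a * s) -> D (p ^+ n * s) -> D s.
Proof.
move=> subD p0 Dp pp Da nap Das; elim: n => [|n IHn]; first by rewrite mul1r.
move=> Dps; apply: IHn.
have Daps : D (a * (p ^+ n.+1 * s) / p).
  rewrite (_ : _ / p = p ^+ n * (a * s)); last by rewrite exprS; field.
  by apply: subringM => //; apply: subringX.
have [//|] := pp _ _ Da Dps Daps.
by rewrite (_ : _ / p = p ^+ n * s) //; rewrite exprS; field.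
Qed.

Hypotheses (subS : subring S) (subA : subring A) (sSA : S `<=` A).
Hypotheses (X0 : X != 0) (Y0 : Y != 0) (Z0 : Z != 0).
Hypotheses (SX : S X) (SZ : S Z) (AVX : A X^-1) (AVZ : A Z^-1).
Hypothesis (SY : forall a, A a -> S (Y * a)).
Hypotheses (pX : prime_in_ring S X) (pZ : prime_in_ring S Z) (pY : prime_in_ring A Y).
Hypotheses (nXZ : ~ S (Z / X)) (nZX : ~ S (X / Z)).
Hypothesis (scaleA : forall a, A a -> exists n, S ((X * Z) ^+ n * a)).

Definition primitive a : Prop := [/\ S a, ~ S (a / X) & ~ S (a / Z)].

Definition monomial (k i j : int) : K := Y ^ k * (X ^ i * Z ^ j).

Hypothesis (factorA : forall a, A a -> a != 0 ->
  exists (k : nat) (i j : int) (b : K), primitive b /\ a = monomial k i j * b).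

Hypothesis (gcdA : forall a b, A a -> A b -> ~ A (a / Y) -> ~ A (b / Y) ->
  exists2 g, g != 0 & forall c, A (c / a) /\ A (c / b) <-> A (c / g)).

Definition lex_nonneg (k i j : int) : Prop :=
  0 < k \/ k = 0 /\ 0 <= i /\ 0 <= j.

Let AX : A X := sSA SX.
Let AZ : A Z := sSA SZ.
Let AY : A Y. Proof. by apply: sSA; rewrite -[Y]mulr1; apply/SY/(subring1 subA). Qed.

Lemma monomial_neq0 k i j : monomial k i j != 0.
Proof. by rewrite /monomial !mulf_neq0 // expfz_neq0. Qed.

Lemma monomialD k i j k' i' j' :
  monomial (k + k') (i + i') (j + j') = monomial k i j * monomial k' i' j'.
Proof. by rewrite /monomial !expfzDr //; ring. Qed.

Lemma monomialB k i j k' i' j' :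
  monomial (k - k') (i - i') (j - j') = monomial k i j / monomial k' i' j'.
Proof.
apply: (canRL (mulfK (monomial_neq0 _ _ _))).
by rewrite -monomialD !subrK.
Qed.

Lemma monomialS (k : nat) i j : monomial k.+1 i j = Y * monomial k i j.
Proof. by rewrite /monomial -[Y ^ k.+1]exprnP exprS -mulrA. Qed.

Lemma monomial_in (k : nat) i j : A (monomial k i j).
Proof.
rewrite /monomial -exprnP; apply: subringM => //; first exact: subringX.
by apply: subringM => //; apply: subringXz.
Qed.

Lemma primitive_neq0 a : primitive a -> a != 0.
Proof.
by case=> _ + _; apply: contra_notN => /eqP ->; rewrite mul0r; apply: subring0.
Qed.

(** Since [X] is a unit of [A] and [YA] lies in [S], divisibility by [Y] in [A] entails divisibility
    by [X] in [S]. *)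
Lemma primitive_ndivY a : primitive a -> ~ A (a / Y).
Proof.
case=> Sa naX _ AaY; apply: naX.
rewrite (_ : a / X = Y * (a / Y / X)); last by field; rewrite X0 Y0.
by apply: SY; apply: subringM.
Qed.

(** Some power of [X Z] carries [c / a] into [S]; the powers of [X] and [Z] then cancel, since
    neither prime divides [a]. *)
Lemma primitive_div a c : primitive a -> S c -> A (c / a) -> S (c / a).
Proof.
move=> pa Sc Aca; have a0 := primitive_neq0 pa; case: pa => Sa naX naZ.
have Saca : S (a * (c / a)) by rewrite mulrC divfK.
have [n] := scaleA Aca; rewrite exprMn -mulrA => Sn.
apply: (cancel_prime subS Z0 SZ pZ Sa naZ Saca (n := n)).
apply: (cancel_prime subS X0 SX pX Sa naX _ Sn).
by rewrite mulrCA; apply: subringM => //; apply: subringX.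
Qed.

(** For negative [i], clearing denominators would make [p] divide some [p' ^+ k * b], hence [p'] or
    [b]. The pair [p], [p'] stands for [X], [Z] in either order. *)
Lemma primitive_exp_ge0 (p p' : K) i j b :
  p != 0 -> p' != 0 -> S p -> S p' -> prime_in_ring S p ->
  ~ S (p' / p) -> S b -> ~ S (b / p) -> S (p ^ i * p' ^ j * b) -> (0 <= i)%R.
Proof.
move=> p0 p0' Sp Sp' pp npp Sb nb; case: i => // n Sn.
have [k Sk] : exists k, S (p' ^+ k * b / p).
  have {}Sn : S (p' ^ j * b / p).
    rewrite (_ : _ / p = p ^+ n * (p ^ Negz n * p' ^ j * b)).
      by apply: subringM => //; apply: subringX.
    rewrite NegzE -exprnN exprS; field.
    by rewrite p0 expf_neq0.
  case: j Sn => k Sk; first by exists k.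
  exists 0%N; rewrite mul1r (_ : b / p = p' ^+ k.+1 * (p' ^ Negz k * b / p)).
    by apply: subringM => //; apply: subringX.
  by rewrite NegzE -exprnN; field; rewrite p0 expf_neq0.
have {Sk} := pp _ _ (subringX subS k Sp') Sb Sk; case=> // {nb}.
elim: k => [|k IHk] Sk; apply: False_ind.
  apply: npp; rewrite -[p']mulr1 -mulrA; exact: subringM.
by rewrite exprS in Sk; have [/npp|/IHk] := pp _ _ Sp' (subringX subS k Sp') Sk.
Qed.

(** As [YA] lies in [S], a positive [k] outweighs all [i] and [j]. For [k = 0] the primes [X] and
    [Z] decide, and [k < 0] would make [Y] divide [c] in [A]. *)
Lemma monomial_div_in a c k i j : primitive a -> primitive c ->
  S (monomial k i j * (c / a)) <-> lex_nonneg k i j /\ A (c / a).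
Proof.
move=> pa pc; have [a0 c0] := (primitive_neq0 pa, primitive_neq0 pc).
have nay := primitive_ndivY pa; have ncy := primitive_ndivY pc.
have [[Sa naX naZ] [Sc ncX ncZ]] := (pa, pc).
split=> [Sm|[[k0|[-> [i0 j0]]] Ac]]; last 2 first.
- case: k k0 => // -[//|k] _.
  rewrite /monomial -exprnP exprS -!mulrA; apply: SY; rewrite !mulrA -[_ * _ * Z ^ j]mulrA.
  by rewrite -mulrA; apply: subringM => //; apply: monomial_in.
- have := primitive_div pa Sc Ac; apply: subringM => //.
  rewrite /monomial expr0z mul1r.
  case: i i0 => // i _; case: j j0 => // j _.
  by apply: subringM => //; apply: subringX.
have [k0|k0] := ltrP k 0.
  case: k k0 Sm => // k _ Sm; case: ncy.
  rewrite (_ : c / Y = a * (monomial k (- i) (- j) * (monomial (Negz k) i j * (c / a)))).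
    by apply: subringM subA _ _ (sSA Sa) _; apply: subringM (monomial_in _ _ _) (sSA Sm).
  rewrite [monomial k _ _ * _]mulrA -monomialD !addNr NegzE -addn1 PoszD opprD addrA.
  rewrite subrr add0r /monomial !expr0z exprN1; field; by rewrite a0 Y0.
case: k k0 Sm => // k _ Sm.
have Ac : A (c / a).
  apply: (cancel_prime subA Y0 AY pY (sSA Sa) nay (n := k)).
    by rewrite mulrC divfK //; apply: sSA.
  rewrite (_ : _ * _ = monomial 0 (- i) (- j) * (monomial k i j * (c / a))).
    by apply: subringM subA _ _ (monomial_in 0 _ _) (sSA Sm).
  by rewrite [monomial 0 _ _ * _]mulrA -monomialD !addNr add0r /monomial !expr0z !mulr1.
split=> //; case: k Sm => [|k] Sm; last by left.
right; move: Sm; rewrite /monomial expr0z mul1r => Sm.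
have Sca := primitive_div pa Sc Ac.
have ndiv p : ~ S (c / p) -> ~ S (c / a / p).
  apply: contra_not => Sp; rewrite (_ : c / p = a * (c / a / p)); last first.
    by rewrite mulrA [a * _]mulrC divfK.
  exact: subringM.
split=> //; split; first by apply: (primitive_exp_ge0 X0 Z0 SX SZ pX nXZ Sca (ndiv _ ncX) Sm).
rewrite [X ^ i * _]mulrC in Sm.
by apply: (primitive_exp_ge0 Z0 X0 SZ SX pZ nZX Sca (ndiv _ ncZ) Sm).
Qed.

(** Recording that [k3] is [k] or [k'] lets the exponent of [Y] in the join stay natural, as
    [monomial_in] requires. *)
Lemma lex_join (k i j k' i' j' : int) : exists k3 i3 j3 : int,
  (k3 = k \/ k3 = k') /\ forall p r q : int,
  lex_nonneg (p - k) (r - i) (q - j) /\ lex_nonneg (p - k') (r - i') (q - j') <->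
  lex_nonneg (p - k3) (r - i3) (q - j3).
Proof.
have [lt|gt|eqk] := ltgtP k k'.
- exists k', i', j'; split; [by right|move=> p r q; rewrite /lex_nonneg; lia].
- exists k, i, j; split; [by left|move=> p r q; rewrite /lex_nonneg; lia].
exists k, (Num.max i i'), (Num.max j j'); split; first by left.
by move=> p r q; rewrite /lex_nonneg; lia.
Qed.

(** The multiple given by [gcdA] is normalized: its powers of [X] and [Z] are units of [A], and [Y]
    cannot divide it, as [Y] would then divide [a b], hence [a] or [b]. *)
Lemma primitive_gcd a b : primitive a -> primitive b ->
  exists2 g, primitive g & forall c, A (c / a) /\ A (c / b) <-> A (c / g).
Proof.
move=> pa pb; have [a0 b0] := (primitive_neq0 pa, primitive_neq0 pb).
have nay := primitive_ndivY pa; have nby := primitive_ndivY pb.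
have [Aa Ab] : A a /\ A b by case: pa pb => [/sSA ? _ _] [/sSA ? _ _].
have [g g0 gP] := gcdA Aa Ab nay nby.
have Ag : A g.
  have [Aga _] : A (g / a) /\ A (g / b) by apply/gP; rewrite divff //; case: subA.
  by rewrite -[g](divfK a0); apply: subringM.
have [k [i [j [h [ph eqg]]]]] := factorA Ag g0.
have h0 := primitive_neq0 ph.
case: k eqg => [|k] eqg; last first.
  have Aabg : A (a * b / g).
    by apply/gP; rewrite mulfK // [a * b]mulrC mulfK.
  have [|/nay//|/nby//] := pY Aa Ab.
  rewrite (_ : a * b / Y = a * b / g * (g / Y)); last by rewrite mulrA divfK.
  apply: subringM => //; rewrite eqg monomialS -mulrA mulrC mulKf //.
  by apply: subringM (monomial_in _ _ _) _ => //; case: ph => /sSA.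
exists h => // c; rewrite gP; have m0 := monomial_neq0 0 i j.
split=> Ac.
  rewrite (_ : c / h = monomial 0 i j * (c / g)); first exact: subringM (monomial_in 0 _ _) Ac.
  by rewrite eqg; field; rewrite h0 m0.
rewrite (_ : c / g = monomial 0 (- i) (- j) * (c / h)).
  exact: subringM (monomial_in 0 _ _) Ac.
rewrite (_ : monomial 0 (- i) (- j) = (monomial 0 i j)^-1).
  by rewrite eqg invfM [RHS]mulrCA mulrA.
by apply: (mulIf m0); rewrite -monomialD !addNr add0r mulVf // /monomial !expr0z !mulr1.
Qed.

Lemma lexicographic_gcd_domain : gcd_domain S.
Proof.
split.
  split=> [|a b|a b]; rewrite ?inE; first exact: subring1.
    exact: subringB.
  exact: subringM.
move=> a b Sa Sb.
have mulsetE d c : d != 0 -> [set d * s | s in S] c <-> S (c / d).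
  move=> d0; split=> [[s Ss <-]|Sc]; first by rewrite mulrC mulKf.
  by exists (c / d) => //; rewrite mulrC divfK.
have mulset0 c : [set 0 * s | s in S] c <-> c = 0.
  split=> [[s _ <-]|->]; first by rewrite mul0r.
  by exists 0; [exact: subring0|rewrite mulr0].
have mul0set d : [set d * s | s in S] 0 by exists 0; [exact: subring0|rewrite mulr0].
have [->|a0] := eqVneq a 0.
  exists 0; first exact: subring0.
  apply/seteqP; split=> [c []//|c c0]; split=> //.
  by move/mulset0: c0 => ->; apply: mul0set.
have [->|b0] := eqVneq b 0.
  exists 0; first exact: subring0.
  apply/seteqP; split=> [c []//|c c0]; split=> //.
  by move/mulset0: c0 => ->; apply: mul0set.
have [k [i [j [a' [pa eqa]]]]] := factorA (sSA Sa) a0.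
have [k' [i' [j' [b' [pb eqb]]]]] := factorA (sSA Sb) b0.
have [g pg gP] := primitive_gcd pa pb.
have [k3 [i3 [j3 [k3E joinP]]]] := lex_join k i j k' i' j'.
(* The generator combines the join of the exponents with the least common multiple of the primitive
   parts. *)
pose c := monomial k3 i3 j3 * g.
have g0 := primitive_neq0 pg.
have c0 : c != 0 by rewrite mulf_neq0 // monomial_neq0.
have Ac : A c.
  apply: subringM subA _ _ _ _; last by case: pg => /sSA.
  by case: k3E => ->; apply: monomial_in.
have cP d : d != 0 -> A d -> S (d / a) /\ S (d / b) <-> S (d / c).
  move=> d0 Ad; have [p [r [q [e [pe eqd]]]]] := factorA Ad d0.
  have divE k0 i0 j0 f : primitive f ->
      S (d / (monomial k0 i0 j0 * f)) <-> lex_nonneg (p%:Z - k0) (r - i0) (q - j0) /\ A (e / f).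
    move=> pf; rewrite -monomial_div_in // monomialB eqd.
    have f0 := primitive_neq0 pf; have m0 := monomial_neq0 k0 i0 j0.
    by rewrite (_ : _ / (_ * f) = monomial p r q / monomial k0 i0 j0 * (e / f)) //;
       field; rewrite f0 m0.
  rewrite eqa eqb !divE // -gP -joinP; tauto.
have Sc : S c.
  rewrite -[c](divfK a0); apply: subringM => //.
  by have [] : S (c / a) /\ S (c / b) by apply/(cP _ c0 Ac); rewrite divff //; exact: subring1.
exists c => //; apply/seteqP; split=> d.
  move=> [/mulsetE-/(_ a0) Sda /mulsetE-/(_ b0) Sdb].
  have [->|d0] := eqVneq d 0; first exact: mul0set.
  apply/mulsetE => //; apply/cP => //.
  by apply: sSA; rewrite -[d](divfK a0); apply: subringM.
move=> /mulsetE-/(_ c0) Sdc.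
have [->|d0] := eqVneq d 0; first by split; exact: mul0set.
have [|Sda Sdb] := (cP d d0 _).2 Sdc.
  by apply: sSA; rewrite -[d](divfK c0); apply: subringM.
by split; apply/mulsetE.
Qed.

End LexicographicGcd.

(** * Adjoining one element *)

Lemma ideal_gen3 (T : comNzRingType) (D : set T) (a b c u : T) :
  ideal_gen D [:: a; b; c] u <->
  exists p q r, [/\ D p, D q, D r & u = p * a + q * b + r * c].
Proof.
split=> [[d Dd ->]|[p [q [r [Dp Dq Dr ->]]]]].
  exists (d ord0), (d (lift ord0 ord0)), (d (lift ord0 (lift ord0 ord0))).
  by split=> //; rewrite !big_ord_recl big_ord0 addr0 addrA.
exists (fun i => [:: p; q; r]`_i) => [[[|[|[|i]]] lti] //|].
by rewrite !big_ord_recl big_ord0 addr0 addrA.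
Qed.

Section Adjoin.
Variables (K : fieldType) (D : set K) (t : K).
Hypothesis subD : subring D.
Implicit Types a b c s : K.

Lemma subring_sum n (F : 'I_n -> K) : (forall i, D (F i)) -> D (\sum_(i < n) F i).
Proof.
move=> DF; elim/big_ind: _ => // [|a b]; first exact: subring0.
exact: subringD.
Qed.

Lemma subring_adjoin : subring (adjoin D t).
Proof.
split.
- exists 1; rewrite ?hornerE //= => i; rewrite coef1.
  by case: (i == 0)%N; [exact: subring1|exact: subring0].
- move=> _ _ [p Dp <-] [q Dq <-]; exists (p - q); rewrite ?hornerE // => i.
  by rewrite coefB; apply: subringB.
- move=> _ _ [p Dp <-] [q Dq <-]; exists (p * q); rewrite ?hornerE // => i.
  by rewrite coefM; apply: subring_sum => j; apply: subringM.
Qed.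

Lemma adjoin_const : D `<=` adjoin D t.
Proof.
move=> c Dc; exists c%:P; rewrite ?hornerE // => i /=; rewrite coefC.
by case: (i == 0)%N => //; exact: subring0.
Qed.

Lemma adjoin_gen : adjoin D t t.
Proof.
exists 'X; rewrite ?hornerE // => i /=; rewrite coefX.
by case: (i == 1)%N; [exact: subring1|exact: subring0].
Qed.

Lemma adjoin_split a : adjoin D t a ->
  exists c s, [/\ D c, adjoin D t s & a = c + s * t].
Proof.
case=> p; elim/poly_ind: p => [|p c _] Dp <-.
  exists 0, 0; rewrite horner0 mul0r addr0; split=> //; first exact: subring0.
  exact: subring0 subring_adjoin.
exists c, p.[t]; split; last by rewrite !hornerE addrC.
  by have := Dp 0%N; rewrite coefD coefMX coefC add0r.
by exists p => // i; have := Dp i.+1; rewrite coefD coefMX coefC addr0.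
Qed.

Lemma adjoin_sub (E : set K) : subring E -> D `<=` E -> E t -> adjoin D t `<=` E.
Proof.
move=> subE sDE Et _ [p Dp <-]; rewrite horner_coef.
elim/big_ind: _ => [|a b|i _]; first exact: subring0.
  exact: subringD.
by apply: subringM => //; [apply/sDE/Dp|exact: subringX].
Qed.

End Adjoin.

(** * The pullback ring *)

Section PullbackRing.
Variables (R : idomainType) (K : fieldType) (iota : {rmorphism R -> K}) (x y z : R).
Hypothesis inj_iota : injective iota.
Implicit Types (r f g u v : R) (a b : K).

Local Notation X := (iota x).
Local Notation Y := (iota y).
Local Notation Z := (iota z).

Definition denominator : set R := [set u | exists n e, u = (x * z) ^+ n + y * e].

Definition fractions : set K :=
  [set a | exists f u, denominator u /\ a = iota f / iota u].

(* [R + yA], for the ring [A] of fractions. *)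
Definition pullback : set K := [set a | exists r, fractions ((a - iota r) / Y)].

Local Notation A := fractions.
Local Notation S := pullback.

Hypotheses (y0 : y != 0) (py : is_prime (span [:: y])).
Hypotheses (nxyz : ~ span [:: x; y] z) (nzyx : ~ span [:: z; y] x).

Lemma span1P (r g : R) : span [:: g] r <-> exists c, r = c * g.
Proof.
split=> [[_ -> [c ->]]|[c ->]]; first by exists c; rewrite add0r.
by exists 0 => //; exists c; rewrite add0r.
Qed.

Lemma iota_eq0 r : (iota r == 0) = (r == 0).
Proof. by rewrite -(inj_eq inj_iota) rmorph0. Qed.

Let Y0 : Y != 0. Proof. by rewrite iota_eq0. Qed.

Lemma ndvd_y_x : ~ span [:: y] x.
Proof. by move=> yx; apply: nzyx; apply: sub_extend. Qed.

Lemma ndvd_y_z : ~ span [:: y] z.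
Proof. by move=> yz; apply: nxyz; apply: sub_extend. Qed.

Let X0 : X != 0.
Proof. by rewrite iota_eq0; apply: contra_notN ndvd_y_x => /eqP ->; exact: (ideal_span _).1. Qed.

Let Z0 : Z != 0.
Proof. by rewrite iota_eq0; apply: contra_notN ndvd_y_z => /eqP ->; exact: (ideal_span _).1. Qed.

Lemma ndvd_y_denominator u : denominator u -> ~ span [:: y] u.
Proof.
case: (py) => Iy _ yM [n [e ->]]; rewrite addrC => yu.
have yye : span [:: y] (y * e) by apply/span1P; exists e; rewrite mulrC.
by have /(prime_exp py)/yM[] := idealDl Iy yye yu; [exact: ndvd_y_x|exact: ndvd_y_z].
Qed.

Lemma denominator_neq0 u : denominator u -> iota u != 0.
Proof.
move/ndvd_y_denominator; apply: contra_notN; rewrite iota_eq0 => /eqP ->.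
exact: (ideal_span _).1.
Qed.

Lemma denominator1 : denominator 1.
Proof. by exists 0%N, 0; rewrite mulr0 addr0. Qed.

Lemma denominatorM u v : denominator u -> denominator v -> denominator (u * v).
Proof.
move=> [n [e ->]] [k [e' ->]]; exists (n + k)%N.
exists ((x * z) ^+ n * e' + e * (x * z) ^+ k + y * e * e').
by rewrite exprD; ring.
Qed.

Lemma subring_fractions : subring A.
Proof.
split; first by exists 1, 1; split; [exact: denominator1|rewrite divff // rmorph1 oner_neq0].
  move=> _ _ [f [u [Uu ->]]] [g [v [Uv ->]]]; exists (f * v - g * u), (u * v).
  split; first exact: denominatorM.
  have [u0 v0] := (denominator_neq0 Uu, denominator_neq0 Uv).
  by rewrite rmorphB !rmorphM; field; rewrite u0 v0.
move=> _ _ [f [u [Uu ->]]] [g [v [Uv ->]]]; exists (f * g), (u * v).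
split; first exact: denominatorM.
have [u0 v0] := (denominator_neq0 Uu, denominator_neq0 Uv).
by rewrite !rmorphM; field; rewrite u0 v0.
Qed.

Lemma fractions_iota r : A (iota r).
Proof. by exists r, 1; split; [exact: denominator1|rewrite rmorph1 divr1]. Qed.

Lemma fractions_inv u : denominator u -> A (iota u)^-1.
Proof. by move=> Uu; exists 1, u; split; rewrite // rmorph1 mul1r. Qed.

Lemma fractions_clear a : A a -> exists u f, denominator u /\ iota f = iota u * a.
Proof.
move=> [f [u [Uu ->]]]; exists u, f; split=> //.
by rewrite mulrC divfK // denominator_neq0.
Qed.

(** Denominators avoid the prime [(y)], so inverting them creates no new divisibility by [y]. *)
Lemma fractions_divY r : A (iota r / Y) <-> span [:: y] r.
Proof.
split=> [/fractions_clear[u [f [Uu]]]|/span1P[c ->]]; last first.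
  by rewrite rmorphM mulfK //; exact: fractions_iota.
rewrite mulrA => /esym/(canRL (divfK Y0)); rewrite -!rmorphM => /inj_iota eqf.
case: (py) => _ _ /(_ u r)[|/ndvd_y_denominator//|//].
by apply/span1P; exists f.
Qed.

Lemma fractions_invX : A X^-1.
Proof.
have Uxz : denominator (x * z) by exists 1%N, 0; rewrite expr1 mulr0 addr0.
rewrite (_ : X^-1 = Z * (iota (x * z))^-1); last first.
  by rewrite rmorphM; field; rewrite X0 Z0.
apply: subringM subring_fractions _ _ (fractions_iota z) (fractions_inv Uxz).
Qed.

Lemma fractions_invZ : A Z^-1.
Proof.
have Uxz : denominator (x * z) by exists 1%N, 0; rewrite expr1 mulr0 addr0.
rewrite (_ : Z^-1 = X * (iota (x * z))^-1); last first.
  by rewrite rmorphM; field; rewrite X0 Z0.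
apply: subringM subring_fractions _ _ (fractions_iota x) (fractions_inv Uxz).
Qed.

Lemma pullbackY a : A a -> S (Y * a).
Proof. by move=> Aa; exists 0; rewrite rmorph0 subr0 [Y * a]mulrC mulfK. Qed.

Lemma pullback_iota r : S (iota r).
Proof. by exists r; rewrite subrr mul0r; exact: subring0 subring_fractions. Qed.

Lemma pullbackP a : S a <-> exists r, exists2 b, A b & a = iota r + Y * b.
Proof.
split=> [[r Ar]|[r [b Ab ->]]]; exists r.
  by exists ((a - iota r) / Y) => //; rewrite mulrC divfK // addrC subrK.
by rewrite [_ + Y * b]addrC addrK [Y * b]mulrC mulfK.
Qed.

Lemma sub_pullback_fractions : S `<=` A.
Proof.
move=> _ /pullbackP[r [b Ab ->]]; apply: subringD subring_fractions _ _ _ _.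
  exact: fractions_iota.
by apply: subringM subring_fractions _ _ (fractions_iota y) Ab.
Qed.

Lemma subring_pullback : subring S.
Proof.
have sA := subring_fractions.
split; first by rewrite -(rmorph1 iota); exact: pullback_iota.
  move=> _ _ /pullbackP[r [a Aa ->]] /pullbackP[s [b Ab ->]]; apply/pullbackP.
  by exists (r - s), (a - b); [exact: subringB|rewrite rmorphB; ring].
move=> _ _ /pullbackP[r [a Aa ->]] /pullbackP[s [b Ab ->]]; apply/pullbackP.
exists (r * s), (iota r * b + a * iota s + Y * a * b); last by rewrite rmorphM; ring.
by apply: subringD => //; [apply: subringD => //|]; do ?apply: subringM => //;
   apply: fractions_iota.
Qed.

(** As [p] is a unit of [A], [Y b = p (Y (b / p))] is a multiple of [p] in [S]; thus [S / pS] is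
    [R / (p, y)]. *)
Lemma pullback_div p r b : p != 0 -> A (iota p)^-1 -> A b ->
  S ((iota r + Y * b) / iota p) <-> span [:: p; y] r.
Proof.
have sA := subring_fractions => p0 Ap Ab; have ip0 : iota p != 0 by rewrite iota_eq0.
split=> [/pullbackP[s [c Ac]]|[i /span1P[d ->] [e ->]]].
  move/(canRL (divfK ip0)) => eqr.
  exists (r - s * p); last by exists s; rewrite subrK.
  apply/fractions_divY; rewrite (_ : _ / Y = iota p * c - b).
    by apply: subringB => //; apply: subringM => //; exact: fractions_iota.
  apply: (canLR (mulfK Y0)); rewrite rmorphB rmorphM.
  by rewrite -[iota r](addrK (Y * b)) eqr; ring.
apply/pullbackP; exists e, ((iota d + b) / iota p).
  by apply: subringM => //; apply: subringD => //; exact: fractions_iota.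
by rewrite rmorphD !rmorphM; field.
Qed.

Lemma pullback_div_iota p r : p != 0 -> A (iota p)^-1 ->
  S (iota r / iota p) <-> span [:: p; y] r.
Proof.
move=> p0 Ap; have A0 := subring0 subring_fractions.
by rewrite -[iota r]addr0 -(mulr0 Y) pullback_div.
Qed.

Lemma prime_in_pullback p : p != 0 -> A (iota p)^-1 -> is_prime (span [:: p; y]) ->
  prime_in_ring S (iota p).
Proof.
have sA := subring_fractions => p0 Ap [_ _ pM].
move=> _ _ /pullbackP[r [a Aa ->]] /pullbackP[s [b Ab ->]].
have Ac : A (iota r * b + a * iota s + Y * a * b).
  by apply: subringD => //; [apply: subringD => //|]; do ?apply: subringM => //;
     apply: fractions_iota.
rewrite (_ : (_ + _) * _ = iota (r * s) + Y * (iota r * b + a * iota s + Y * a * b)).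
  by move=> /pullback_div-/(_ p0 Ap Ac)/pM[] prs; [left|right]; apply/pullback_div.
by rewrite rmorphM; ring.
Qed.

Lemma prime_in_fractions : prime_in_ring A Y.
Proof.
move=> a b Aa Ab.
have [u [f [Uu eqf]]] := fractions_clear Aa.
have [v [g [Uv eqg]]] := fractions_clear Ab => Aab.
have divU c w h : denominator w -> iota h = iota w * c -> span [:: y] h -> A (c / Y).
  move=> Uw eqh /fractions_divY; rewrite eqh => Ac.
  rewrite (_ : c / Y = (iota w)^-1 * (iota w * c / Y)).
    by apply: subringM subring_fractions _ _ (fractions_inv Uw) Ac.
  by field; rewrite Y0 denominator_neq0.
case: (py) => _ _ /(_ f g)[]; last 2 first.
- by move=> yf; left; apply: divU eqf yf.
- by move=> yg; right; apply: divU eqg yg.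
apply/fractions_divY; rewrite rmorphM eqf eqg.
rewrite (_ : _ / Y = iota (u * v) * (a * b / Y)); last by rewrite rmorphM; ring.
by apply: subringM subring_fractions _ _ (fractions_iota _) Aab.
Qed.

(** If [a = f / u] with [u = (xz)^n + y e], then [(xz)^n a = f - y e a]. *)
Lemma fractions_scale a : A a -> exists n, S ((X * Z) ^+ n * a).
Proof.
move=> Aa; have [f [u [Uu eqa]]] := Aa; case: (Uu) => n [e equ]; exists n.
apply/pullbackP; exists f, (- iota e * a).
  apply: subringM subring_fractions _ _ _ Aa; apply: subringN subring_fractions _ _.
  exact: fractions_iota.
have eqn : (X * Z) ^+ n = iota u - Y * iota e.
  by rewrite equ rmorphD rmorphXn !rmorphM addrK.
rewrite eqn mulrBl {1}eqa mulrC divfK ?denominator_neq0 //; ring.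
Qed.

(** Up to units of [A], [a] and [b] are elements [f] and [h] of [R] outside the prime [(y)]. Hence
    [y] cancels on the intersection of [(f)] and [(h)], and the assumed principality yields their
    least common multiple in [A]. *)
Lemma fractions_gcd a b :
  (forall J, ideal J -> (forall r, J (y * r) -> J r) ->
    exists g n e, J g /\ forall j, J j -> exists c, ((x * z) ^+ n + y * e) * j = c * g) ->
  A a -> A b -> ~ A (a / Y) -> ~ A (b / Y) ->
  exists2 g, g != 0 & forall c, A (c / a) /\ A (c / b) <-> A (c / g).
Proof.
move=> satR Aa Ab nay nby; have sA := subring_fractions.
have [_ _ yM] := py.
have [u [f [Uu eqf]]] := fractions_clear Aa.
have [v [h [Uv eqh]]] := fractions_clear Ab.
have nd c w k : denominator w -> iota k = iota w * c -> ~ A (c / Y) -> ~ span [:: y] k.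
  move=> Uw eqk; apply: contra_not => /fractions_divY; rewrite eqk => Ak.
  rewrite (_ : c / Y = (iota w)^-1 * (iota w * c / Y)).
    by apply: subringM => //; exact: fractions_inv.
  by field; rewrite Y0 denominator_neq0.
have nf := nd _ _ _ Uu eqf nay; have nh := nd _ _ _ Uv eqh nby.
have nz k : ~ span [:: y] k -> k != 0.
  by apply: contra_notN => /eqP ->; exact: (ideal_span _).1.
have [f0 h0] := (nz _ nf, nz _ nh).
have [if0 ih0] : iota f != 0 /\ iota h != 0 by rewrite !iota_eq0.
have cancel k r : ~ span [:: y] k -> k != 0 -> span [:: k] (y * r) -> span [:: k] r.
  move=> nk k0 /span1P[c eqc]; have [|/span1P[d eqd]|//] := yM c k.
    by apply/span1P; exists r; rewrite -eqc mulrC.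
  apply/span1P; exists d; apply: (mulfI y0).
  by rewrite eqc eqd mulrA [y * d]mulrC.
have [||g [n [e [[gf gh] gP]]]] := satR (span [:: f] `&` span [:: h]).
- split=> [|c r s [fr hr] [fs hs]]; first by split; exact: (ideal_span _).1.
  by split; apply: (ideal_span _).2.
- by move=> r [fr hr]; split; [exact: cancel nf f0 fr|exact: cancel nh h0 hr].
have Uw : denominator ((x * z) ^+ n + y * e) by exists n, e.
set w := _ + _ in gP Uw.
have g0 : g != 0.
  have [|c eqc] := gP (f * h).
    by split; apply/span1P; [exists h; rewrite mulrC|exists f].
  have : w * (f * h) != 0 by rewrite !mulf_neq0 // -iota_eq0 denominator_neq0.
  by apply: contra_neq => g0; rewrite eqc g0 mulr0.
have ig0 : iota g != 0 by rewrite iota_eq0.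
have w0 := denominator_neq0 Uw.
exists (iota g) => // c.
have assoc d s k : denominator s -> iota k = iota s * d -> iota k != 0 ->
    A (c / d) <-> A (c / iota k).
  move=> Us eqk k0; have s0 := denominator_neq0 Us.
  have d0 : d != 0 by apply: contraNneq k0 => d0; rewrite eqk d0 mulr0.
  split=> Ac.
    rewrite (_ : c / _ = (iota s)^-1 * (c / d)).
      by apply: subringM => //; exact: fractions_inv.
    by rewrite eqk; field; rewrite s0 d0.
  rewrite (_ : c / d = iota s * (c / iota k)).
    by apply: subringM => //; exact: fractions_iota.
  by rewrite eqk; field; rewrite s0 d0.
rewrite (assoc _ _ _ Uu eqf if0) (assoc _ _ _ Uv eqh ih0).
split=> [[/fractions_clear[s [k [Us eqk]]] /fractions_clear[t [l [Ut eql]]]]|Acg].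
  have s0 := denominator_neq0 Us; have t0 := denominator_neq0 Ut.
  have eq1 : iota (f * k * t) = iota (s * t) * c.
    by rewrite !rmorphM eqk; field.
  have eq2 : iota (h * l * s) = iota (s * t) * c.
    by rewrite !rmorphM eql; field.
  have [|d eqd] := gP (f * k * t).
    split; apply/span1P; first by exists (k * t); ring.
    by exists (l * s); rewrite (_ : _ * _ * h = h * l * s); [apply: inj_iota; rewrite eq1 eq2|ring].
  exists d, (w * (s * t)); split; first by do 2?apply: denominatorM.
  apply: (canLR (mulfK ig0)); rewrite [_ / _ * _]mulrAC -rmorphM -eqd rmorphM eq1.
  by rewrite !rmorphM; field; rewrite w0 s0 t0.
case/span1P: gf => d eqd; case/span1P: gh => d' eqd'.
have [d0 d0'] : iota d != 0 /\ iota d' != 0.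
  rewrite !iota_eq0; split; first by apply: contraNneq g0 => d0; rewrite eqd d0 mul0r.
  by apply: contraNneq g0 => d0; rewrite eqd' d0 mul0r.
split.
  rewrite (_ : c / _ = iota d * (c / iota g)).
    by apply: subringM => //; exact: fractions_iota.
  by rewrite eqd rmorphM; field; rewrite if0 d0.
rewrite (_ : c / _ = iota d' * (c / iota g)).
  by apply: subringM => //; exact: fractions_iota.
by rewrite eqd' rmorphM; field; rewrite ih0 d0'.
Qed.


(** Powers of [y] are extracted modulo [0], then powers of [x] and of [z] modulo [(y)]. The
    denominator, congruent to [(xz)^n] modulo [y], shifts the exponents of [X] and [Z] by [-n]. *)
Lemma fractions_factor a :
  (forall P p r, is_prime P -> p \in [:: x; y; z] -> ~ P p -> ~ P r ->
     exists n g, P (r - p ^+ n * g) /\ ~ extend P p g) ->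
  A a -> a != 0 -> exists (k : nat) (i j : int) b,
    primitive S X Z b /\ a = monomial X Y Z k i j * b.
Proof.
move=> factR Aa a0; have sA := subring_fractions.
have [f [u [Uu eqa]]] := Aa; have u0 := denominator_neq0 Uu.
have prime0 : is_prime (span [::] : set R).
  split=> [||r s /eqP]; first exact: ideal_span.
    by apply/eqP; rewrite oner_neq0.
  by rewrite mulf_eq0 => /orP[] /eqP ->; [left|right].
have [|||k [f' [/= /subr0_eq eqf nf']]] := factR _ y f prime0.
- by rewrite !inE eqxx orbT.
- exact/eqP.
- by move=> f0; move: a0; rewrite eqa f0 rmorph0 mul0r eqxx.
have [|||i [g [yf' ng]]] := factR _ x f' py.
- by rewrite mem_head.
- exact: ndvd_y_x.
- exact: nf'.
have [|||j [g' [yg ng']]] := factR _ z g py.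
- by rewrite !inE eqxx !orbT.
- exact: ndvd_y_z.
- by move=> yg; apply: ng; apply: sub_extend.
have nxg' : ~ span [:: x; y] g'.
  move=> xg'; apply: ng; rewrite -[g](subrK (z ^+ j * g')).
  apply: idealD (ideal_span [:: x; y]) _ _; first exact: sub_extend.
  exact: idealM (ideal_span [:: x; y]) _.
have [c eqf'] : exists c, f' = x ^+ i * z ^+ j * g' + y * c.
  have /span1P[c eqc] : span [:: y] (f' - x ^+ i * z ^+ j * g').
    rewrite (_ : _ - _ = (f' - x ^+ i * g) + x ^+ i * (g - z ^+ j * g')); last by ring.
    by apply: idealD (ideal_span _) _ _ => //; apply: idealM (ideal_span _) _.
  by exists c; rewrite [y * c]mulrC -eqc addrC subrK.
case: (Uu) => n [e equ].
pose a' := iota f' / iota u.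
have Aa' : A a' by exists f', u.
pose w := X ^+ i * Z ^+ j; have w0 : w != 0 by rewrite mulf_neq0 // expf_neq0.
(* Chosen so that [w (g' + Y b) = (X Z)^n a']: both sides equal [f' - y e a']. *)
pose b := (iota c - iota e * a') / w.
have Ab : A b.
  apply: subringM => //; last first.
    rewrite /w invfM -!exprVn; apply: subringM => //; apply: subringX => //.
      exact: fractions_invX.
    exact: fractions_invZ.
  by apply: subringB => //; [|apply: subringM => //]; exact: fractions_iota.
have [xn0 zn0] : x != 0 /\ z != 0 by rewrite -!iota_eq0.
exists k, (i%:Z - n%:Z), (j%:Z - n%:Z), (iota g' + Y * b); split.
  split; first by apply/pullbackP; exists g', b.
    by move/(pullback_div g' xn0 fractions_invX Ab).
  by move/(pullback_div g' zn0 fractions_invZ Ab).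
rewrite -[k%:Z]subr0 monomialB // /monomial -!exprnP expr0 mul1r -/w.
have eqw : w * (iota g' + Y * b) = (X * Z) ^+ n * a'.
  have -> : (X * Z) ^+ n = iota u - Y * iota e.
    by rewrite equ rmorphD rmorphXn !rmorphM addrK.
  have -> : iota g' = (iota f' - Y * iota c) / w.
    by rewrite eqf' rmorphD !rmorphM !rmorphXn addrK mulrAC divff // mul1r.
  by rewrite /b /a'; field; rewrite w0 u0.
have Xn0 : X ^+ n != 0 by rewrite expf_neq0.
have Zn0 : Z ^+ n != 0 by rewrite expf_neq0.
rewrite mulrAC -[_ * w * _]mulrA eqw exprMn eqa eqf rmorphM rmorphXn /a'.
by field; rewrite u0 Xn0 Zn0.
Qed.

(** * The union of the monoidal sequence *)

Section MonoidalSequence.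
Variable m : set R.
Hypotheses (im : ideal m) (m1 : ~ m 1) (my : m y).
Hypothesis (unitR : forall r, ~ m r -> exists s, s * r = 1).
Hypotheses (mx : m x) (mz : m z) (gen : m `<=` span [:: z; x; y]).

(** The maximal ideal [m + yA] of [S]; its traces are the ideals at which the successive rings are
    localized. *)
Definition pullback_max : set K := [set a | exists2 r, m r & A ((a - iota r) / Y)].

Local Notation N := pullback_max.

Lemma pullback_maxP a : N a <-> exists r b, [/\ m r, A b & a = iota r + Y * b].
Proof.
split=> [[r mr Ar]|[r [b [mr Ab ->]]]]; exists r => //.
  by exists ((a - iota r) / Y); split=> //; rewrite mulrC divfK // addrC subrK.
by rewrite [_ + Y * b]addrC addrK [Y * b]mulrC mulfK.
Qed.

Lemma pullback_maxD a b : N a -> N b -> N (a + b).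
Proof.
move=> /pullback_maxP[r [c [mr Ac ->]]] /pullback_maxP[s [d [ms Ad ->]]].
apply/pullback_maxP; exists (r + s), (c + d); split; first exact: idealD.
  exact: subringD subring_fractions _ _ Ac Ad.
by rewrite rmorphD; ring.
Qed.

Lemma pullback_maxM a b : S a -> N b -> N (a * b).
Proof.
have sA := subring_fractions.
move=> /pullbackP[r [c Ac ->]] /pullback_maxP[s [d [ms Ad ->]]].
apply/pullback_maxP; exists (r * s), (iota r * d + c * iota s + Y * c * d); split.
- exact: idealM.
- by apply: subringD => //; [apply: subringD => //|]; do ?apply: subringM => //;
     apply: fractions_iota.
- by rewrite rmorphM; ring.
Qed.

Lemma pullback_max_iota r : N (iota r) <-> m r.
Proof.
split=> [[s ms]|mr]; last first.
  by exists r; rewrite // subrr mul0r; exact: subring0 subring_fractions.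
rewrite -rmorphB => /fractions_divY /span1P[c eqc].
rewrite -[r](subrK s) eqc; apply: idealD => //; exact: idealM.
Qed.

Lemma pullback_maxY a : A a -> N (Y * a).
Proof.
move=> Aa; apply/pullback_maxP; exists 0, a; split=> //; first exact: im.1.
by rewrite rmorph0 add0r.
Qed.

Lemma pullback_max1 : ~ N 1.
Proof. by rewrite -(rmorph1 iota) => /pullback_max_iota. Qed.

(** Write [a = r + Y b] with [b = f / u] and [s] the inverse of [r]. Then [a s u = u + y f s] is a
    denominator, so [a] is a unit of [A]; and [s (a - Y b) = 1] shows that its inverse is [s] modulo
    [YA]. *)
Lemma pullback_unit a : S a -> ~ N a -> a != 0 /\ S a^-1.
Proof.
have sA := subring_fractions => Sa nNa.
have a0 : a != 0.
  apply: contra_notN nNa => /eqP ->; rewrite -(rmorph0 iota).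
  exact/pullback_max_iota/im.1.
split=> //; move: Sa nNa => /pullbackP[r [b Ab eqa]] nNa.
have [|s sr] := unitR (r := r).
  by move=> mr; apply: nNa; rewrite eqa; apply/pullback_maxP; exists r, b.
have isr : iota s * iota r = 1 by rewrite -rmorphM sr rmorph1.
have [f [u [Uu eqb]]] := Ab; have u0 := denominator_neq0 Uu.
have Uw : denominator (u + y * (f * s)).
  by case: Uu => n [e ->]; exists n, (e + f * s); ring.
have w0 := denominator_neq0 Uw.
have eqw : a * (iota s * iota u) = iota (u + y * (f * s)).
  rewrite (_ : _ * _ = iota s * iota r * iota u + Y * (iota f * iota s)).
    by rewrite isr mul1r rmorphD !rmorphM.
  by rewrite eqa eqb; field.
have AV : A a^-1.
  exists (s * u), (u + y * (f * s)); split=> //; apply: (mulfI a0).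
  by rewrite divff // [RHS]mulrA rmorphM eqw divff.
apply/pullbackP; exists s, (- (iota s * a^-1 * b)).
  by apply: subringN => //; apply: subringM => //; apply: subringM => //; exact: fractions_iota.
apply: (mulfI a0); rewrite divff //.
rewrite (_ : a * _ = iota s * (a - Y * b)); last by field.
by rewrite eqa addrK isr.
Qed.


(* [D] stands for a member of the monoidal sequence and [t] for the multiple of
   [y] that belongs to its regular system of parameters [x, t, z]. *)
Definition monoidal_invariant (D : set K) (t : K) : Prop :=
  [/\ subring D, forall r, D (iota r), D `<=` S, A (t / Y)
    & forall a, D a -> N a -> ideal_gen D [:: X; t; Z] a].

Section MonoidalStep.
Variables (D : set K) (t t' p : K).
Hypotheses (invD : monoidal_invariant D t) (At' : A (t' / Y)).
Hypotheses (pXZ : p = X \/ p = Z) (eqt : t = p * t').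

Local Notation D' := (adjoin D t').

Let subD : subring D. Proof. by case: invD. Qed.
Let subD' : subring D'. Proof. exact: subring_adjoin. Qed.

Let Dp : D p.
Proof. by case: invD => _ Di _ _ _; case: pXZ => ->. Qed.

Lemma pullback_max_t' : N t'.
Proof. by rewrite -(divfK Y0 t') mulrC; apply: pullback_maxY. Qed.

Lemma pullback_max_XZ : N X /\ N Z.
Proof. by split; apply/pullback_max_iota. Qed.

Lemma adjoin_sub_pullback : D' `<=` S.
Proof.
case: invD => _ _ sDS _ _; apply: adjoin_sub => //; first exact: subring_pullback.
by rewrite -(divfK Y0 t') mulrC; apply: pullbackY.
Qed.

(** The constant term of an element of [N] in [D[t']] is again in [N], hence in [(X, t, Z)D] by the
    invariant, and [t = p t']. *)
Lemma ideal_gen_adjoin a : D' a -> N a <-> ideal_gen D' [:: X; t'; Z] a.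
Proof.
move=> D'a; split=> [Na|/ideal_gen3[b [c [d [Db Dc Dd ->]]]]]; last first.
  have [NX NZ] := pullback_max_XZ; have Nt := pullback_max_t'.
  by apply: pullback_maxD; [apply: pullback_maxD|];
     apply: pullback_maxM => //; apply: adjoin_sub_pullback.
have [c [s [Dc D's eqa]]] := adjoin_split subD D'a.
have [_ _ _ _ ND] := invD.
have /(ND _ Dc)/ideal_gen3[b1 [b2 [b3 [Db1 Db2 Db3 eqc]]]] : N c.
  rewrite (_ : c = a + (- s) * t'); last by rewrite eqa; ring.
  apply: pullback_maxD => //; apply: pullback_maxM pullback_max_t'.
  by apply: subringN subring_pullback _ _; apply: adjoin_sub_pullback.
apply/ideal_gen3; exists b1, (b2 * p + s), b3.
have sub := adjoin_const t' subD.
split; try exact: sub; last by rewrite eqa eqc eqt; ring.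
by apply: subringD => //; apply: sub; apply: subringM.
Qed.

Lemma local_adjoinP a : local_adjoin D X t' Z a <->
  exists b s, [/\ D' b, D' s, ~ N s & a = b / s].
Proof.
split=> [[b Db [s [Ds ns] <-]]|[b [s [Db Ds ns ->]]]].
  by exists b, s; split=> // /(ideal_gen_adjoin Ds).
by exists b => //; exists s => //; split=> // /(ideal_gen_adjoin Ds).
Qed.

Lemma adjoin_sub_local : D' `<=` local_adjoin D X t' Z.
Proof.
move=> a Da; apply/local_adjoinP; exists a, 1; rewrite divr1; split=> //.
  exact: subring1.
exact: pullback_max1.
Qed.

Lemma adjoin_unit s : D' s -> ~ N s -> s != 0 /\ S s^-1.
Proof. by move=> Ds; apply: pullback_unit; apply: adjoin_sub_pullback. Qed.

Lemma max_complementM b s : D' b -> D' s -> ~ N b -> ~ N s -> ~ N (b * s).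
Proof.
move=> Db Ds nb ns Nbs; have [b0 SVb] := adjoin_unit Db nb.
by apply: ns; rewrite -(mulKf b0 s); apply: pullback_maxM.
Qed.

(** Elements outside [N] are units of [S], so localizing stays inside [S], and membership in [N] can
    be tested on numerators. *)
Lemma monoidal_invariant_step : monoidal_invariant (local_adjoin D X t' Z) t'.
Proof.
have [_ Di sDS _ _] := invD; have sDL := adjoin_sub_local.
split=> // [|r||].
- split; first by apply: sDL; exact: subring1.
    move=> _ _ /local_adjoinP[a [s [Da Ds ns ->]]] /local_adjoinP[b [u [Db Du nu ->]]].
    apply/local_adjoinP; exists (a * u - b * s), (s * u); split.
    + by apply: subringB => //; apply: subringM.
    + exact: subringM.
    + exact: max_complementM.
    + have [s0 _] := adjoin_unit Ds ns; have [u0 _] := adjoin_unit Du nu.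
      by field; rewrite s0 u0.
  move=> _ _ /local_adjoinP[a [s [Da Ds ns ->]]] /local_adjoinP[b [u [Db Du nu ->]]].
  apply/local_adjoinP; exists (a * b), (s * u); split.
  + exact: subringM.
  + exact: subringM.
  + exact: max_complementM.
  + have [s0 _] := adjoin_unit Ds ns; have [u0 _] := adjoin_unit Du nu.
    by field; rewrite s0 u0.
- by apply: sDL; apply: adjoin_const.
- move=> _ /local_adjoinP[a [s [Da Ds ns ->]]].
  have [_ SVs] := adjoin_unit Ds ns.
  by apply: subringM subring_pullback _ _ _ SVs; apply: adjoin_sub_pullback.
- move=> _ /local_adjoinP[a [s [Da Ds ns ->]]] Nas.
  have [s0 _] := adjoin_unit Ds ns.
  have /(ideal_gen_adjoin Da)/ideal_gen3[b [c [d [Db Dc Dd eqa]]]] : N a.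
    rewrite -(divfK s0 a) mulrC; apply: pullback_maxM => //.
    exact: adjoin_sub_pullback.
  have Lfrac e : D' e -> local_adjoin D X t' Z (e / s).
    by move=> De; apply/local_adjoinP; exists e, s; split.
  apply/ideal_gen3; exists (b / s), (c / s), (d / s).
  by split; [exact: Lfrac|exact: Lfrac|exact: Lfrac|rewrite eqa; field].
Qed.

End MonoidalStep.

Local Notation Rseq := (monoidal_seq (range iota) X Y Z).

Lemma fractions_monomialV n k : A (Y / (X ^+ n * Z ^+ k) / Y).
Proof.
rewrite mulrAC divff // mul1r invfM -!exprVn.
by apply: subringM subring_fractions _ _ _ _; apply: subringX subring_fractions _ _ _;
   [exact: fractions_invX|exact: fractions_invZ].
Qed.

(** The parameter is divided by [X] when [n] is even and by [Z] when [n] is odd. *)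
Lemma monoidal_seq_parameter n : exists2 p, p = X \/ p = Z &
  Y / (X ^+ uphalf n * Z ^+ n./2) = p * (Y / (X ^+ n./2.+1 * Z ^+ uphalf n)).
Proof.
have [Xn0 Zn0] : X ^+ n./2 != 0 /\ Z ^+ n./2 != 0 by rewrite !expf_neq0.
rewrite uphalf_half; case: (odd n); rewrite /= ?add1n ?add0n !exprS.
  by exists Z; [right|field; rewrite X0 Z0 Xn0 Zn0].
by exists X; [left|field; rewrite X0 Xn0 Zn0].
Qed.

Lemma monoidal_seq_invariant n :
  monoidal_invariant (Rseq n) (Y / (X ^+ uphalf n * Z ^+ n./2)).
Proof.
elim: n => [|n IHn].
  split=> [|r|_ [r _ <-]||_ [r _ <-] /pullback_max_iota/gen].
  - split; first by exists 1; rewrite ?rmorph1.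
      by move=> _ _ [r _ <-] [s _ <-]; exists (r - s); rewrite ?rmorphB.
    by move=> _ _ [r _ <-] [s _ <-]; exists (r * s); rewrite ?rmorphM.
  - by exists r.
  - exact: pullback_iota.
  - exact: fractions_monomialV.
  move=> [_ [_ [_ -> [c ->]] [b ->]] [a ->]]; apply/ideal_gen3.
  exists (iota b), (iota c), (iota a).
  split; [by exists b|by exists c|by exists a|].
  by rewrite /= !expr0 !mulr1 divr1 add0r !rmorphD !rmorphM; ring.
have [p pXZ eqt] := monoidal_seq_parameter n.
(* The new parameter matches by computation: [uphalf n.+1] is [n./2.+1] and [n.+1./2] is
   [uphalf n]. *)
exact: monoidal_invariant_step IHn (fractions_monomialV _ _) pXZ eqt.
Qed.

(** For [u = (xz)^n + y e] and [t = y / (xz)^n], the element [r + y f / u] equals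
    [r + f t / (1 + e t)]. As [1 + e t] is outside [N], it occurs at index [2n + 1]. *)
Lemma bigcup_monoidal_seq : \bigcup_n Rseq n = S.
Proof.
apply/seteqP; split=> [a [n _]|a].
  by have [_ _ + _ _] := monoidal_seq_invariant n; apply.
have sA := subring_fractions.
move=> /pullbackP[r [b [f [u [Uu ->]]] ->]]; case: (Uu) => n [e equ].
have u0 := denominator_neq0 Uu.
have inv := monoidal_seq_invariant n.*2.
have [subD Di _ _ _] := inv.
have [p pXZ eqt] := monoidal_seq_parameter n.*2.
have At' := fractions_monomialV n.*2./2.+1 (uphalf n.*2).
move: inv eqt At'; set t := Y / _; set t' := Y / (_ ^+ _.+1 * _) => inv eqt At'.
have subD' := subring_adjoin t' subD.
(* The invariant only places [t] in [YA]; after adjoining [t'] it is recovered as [p t']. *)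
have D't : adjoin (Rseq n.*2) t' t.
  rewrite eqt; apply: subringM => //; last exact: adjoin_gen.
  by apply: adjoin_const => //; case: pXZ => ->.
have D'i s : adjoin (Rseq n.*2) t' (iota s) by apply: adjoin_const.
have Nt s : N (iota s * t).
  apply: pullback_maxM; first exact: pullback_iota.
  by rewrite -(divfK Y0 t) mulrC; apply: pullback_maxY; exact: fractions_monomialV.
have Xn0 : X ^+ n != 0 by rewrite expf_neq0.
have Zn0 : Z ^+ n != 0 by rewrite expf_neq0.
have eqT : t = Y / (X ^+ n * Z ^+ n) by rewrite /t uphalf_double doubleK.
exists n.*2.+1 => //; apply/(local_adjoinP inv At' pXZ eqt).
exists (iota r * (1 + iota e * t) + iota f * t), (1 + iota e * t).
have eqU : iota u = X ^+ n * Z ^+ n * (1 + iota e * t).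
  by rewrite equ rmorphD rmorphXn !rmorphM exprMn eqT; field; rewrite Xn0 Zn0.
have D's : adjoin (Rseq n.*2) t' (1 + iota e * t).
  by apply: subringD => //; [exact: subring1|exact: subringM].
split=> //.
- by apply: subringD => //; apply: subringM.
- move=> N1; apply: pullback_max1; rewrite -(addrK (iota e * t) 1).
  apply: pullback_maxD => //; rewrite -mulNr -rmorphN; exact: Nt.
have s0 : 1 + iota e * t != 0 by apply: contra_neq u0 => s0; rewrite eqU s0 mulr0.
rewrite eqU; set s := 1 + _ in s0 *; rewrite mulrDl mulfK // eqT; clearbody s.
by congr (_ + _); field; rewrite s0 Xn0 Zn0.
Qed.

End MonoidalSequence.
End PullbackRing.

(** * Assembly in the fraction field of the regular local ring *)

Theorem corollary6p4 (R : idomainType) (m : set R) (x y z : R)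
    (regR : regular_local_ring m 3) (gen_m : m = ideal_gen setT [:: x; y; z]) :
  gcd_domain
    (\bigcup_n monoidal_seq [set a%:F | a in [set: R]] x%:F y%:F z%:F n).
Proof.
case: regR => noethR locR dimR _.
move: gen_m; rewrite ideal_gen_span => gen_m.
have mem a : a \in [:: x; y; z] -> m a by rewrite gen_m; exact: mem_span.
have [mx my mz] : [/\ m x, m y & m z].
  by split; apply: mem; rewrite !inE eqxx ?orbT.
have gen_perm s : {subset [:: x; y; z] <= s} -> m `<=` span s.
  by rewrite gen_m => xyzs; apply: span_sub (ideal_span s) _ => a /xyzs/mem_span.
have gen_z : m `<=` span [:: z; x; y].
  by apply: gen_perm => a; rewrite !inE => /or3P[] ->; rewrite ?orbT.
have gen_x : m `<=` span [:: x; z; y].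
  by apply: gen_perm => a; rewrite !inE => /or3P[] ->; rewrite ?orbT.
have [/eqP y0 py pxy nxyz] := regular_primes noethR locR dimR mx my mz gen_z.
(* The same lemma with [x] and [z] exchanged makes [(z, y)] a prime not containing [x]. *)
have [_ _ pzy nzyx] := regular_primes noethR locR dimR mz my mx gen_x.
have [im m1 _] := local_prime noethR locR.
have unitR := local_unit noethR locR.
pose iota : {rmorphism R -> {fraction R}} := @FracField.tofrac R.
have inj_iota : injective iota by move=> a b /eqP; rewrite tofrac_eq => /eqP.
rewrite (bigcup_monoidal_seq (iota := iota) inj_iota y0 py nxyz nzyx im m1 my unitR mx mz gen_z).
have [x0 z0] : x != 0 /\ z != 0.
  split; apply/eqP => eq0.
    by apply: nzyx; rewrite eq0; exact: (ideal_span _).1.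
  by apply: nxyz; rewrite eq0; exact: (ideal_span _).1.
have iota0 r : r != 0 -> iota r != 0 by rewrite (iota_eq0 inj_iota).
have AVX := fractions_invX inj_iota py nxyz nzyx.
have AVZ := fractions_invZ inj_iota py nxyz nzyx.
apply: (@lexicographic_gcd_domain _ _ (fractions iota x y z) (iota x) (iota y) (iota z)).
- exact: subring_pullback.
- exact: subring_fractions.
- exact: sub_pullback_fractions.
- exact: iota0.
- exact: iota0.
- exact: iota0.
- exact: pullback_iota.
- exact: pullback_iota.
- exact: AVX.
- exact: AVZ.
- exact: pullbackY.
- exact: prime_in_pullback.
- exact: prime_in_pullback.
- exact: prime_in_fractions.
- by move/(pullback_div_iota inj_iota y0 py nxyz nzyx z x0 AVX).
- by move/(pullback_div_iota inj_iota y0 py nxyz nzyx x z0 AVZ).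
- exact: fractions_scale.
- move=> a; apply: fractions_factor => // P p r primeP pxyz nPp nPr.
  by apply: (prime_power_factor noethR locR) => //; apply: mem.
- move=> a b; apply: fractions_gcd => // J IJ satJ.
  exact: (saturated_principal_up_to_unit noethR locR mx mz gen_z pxy nxyz).
Qed.
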